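(* For every standard word $w$ and every positive integer $k$, $$\sum_{i=1}^{k}\mathrm{ctype}(w)_i = I_k(\tilde w).$$
   Context: A standard word of length $n$ is a permutation $w=w_1\cdots w_n$ of $1,\dots,n$. Tableaux are in English notation; $\mathrm{rowword}(T)$ is the row reading word (rows read left to right, from the bottom row to the top row); $P(w)$ is the (Schensted row) insertion tableau of a word $w$. Cocharge labeling: the cocharge labeling $w^{\mathrm{cc}}$ of a standard word $w$ is the word of the same length obtained by labeling the numbers of $w$ in increasing order: $1$ is labeled $0$, and if $i$ is labeled $k$, then $i+1$ is labeled $k$ (resp. $k+1$) if $i+1$ appears to the right (resp. left) of $i$ in $w$; the label of $w_j$ is placed in position $j$. Chains: let $w$ be a standard word of length $n$ and $z=w^{\mathrm{cc}}=z_1\cdots z_n$. Define $\tilde w:\mathbb{Z}_{\le n}\to\mathbb{Z}_{\ge 0}$ by $\tilde w(i)=z_{i+mn}+m$, where $m$ is the unique integer with $i+mn\in\{1,\dots,n\}$. Let $\bar{\ }:\mathbb{Z}_{\le n}\to\mathbb{Z}/n\mathbb{Z}$ be reduction mod $n$. A chain of $\tilde w$ of length $k'+1$ is a sequence $\mathbf{j}=(j_{k'},j_{k'-1},\dots,j_0)$ of elements of $\mathbb{Z}_{\le n}$ such that $j_{k'}<j_{k'-1}<\cdots<j_0$, $\tilde w(j_i)=i$ for all $0\le i\le k'$, and $\bar{j_i}\ne\bar{j_{i'}}$ for all $i\neq i'$ in $\{0,\dots,k'\}$. Its underlying set is $\mathbf{j}^*=\{j_{k'},\dots,j_0\}$.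 A $k$-bounded chain family of $\tilde w$ is a set $\{A_1,\dots,A_l\}$ of chains of $\tilde w$ of lengths at most $k$ such that the images in $\mathbb{Z}/n\mathbb{Z}$ of the underlying sets $A_1^*,\dots,A_l^*$ are pairwise disjoint. Its support is $\bigcup_i A_i^*$ and its size is the cardinality of its support. $I_k(\tilde w)$ is the maximum size of a $k$-bounded chain family of $\tilde w$. Catabolizability: for a tableau $T$ with distinct entries and with at least $m$ squares in its first row, $T_{(m)}$ is the subtableau formed by the first $m$ squares of the first row, and the $m$-catabolism is $\mathrm{cat}_m(T)=P(\mathrm{rowword}(T_n)\,\mathrm{rowword}(T_s))$, where $T_n$ is the first row of $T$ with $T_{(m)}$ removed and $T_s$ consists of the remaining rows of $T$. For a partition $\lambda$ of $|T|$ (the number of squares of $T$), $T$ is $\lambda$-catabolizable if its first row has at least $\lambda_1$ squares, $T_{(\lambda_1)}$ contains the $\lambda_1$ smallest entries of $T$, and $\mathrm{cat}_{\lambda_1}(T)$ is $\widehat\lambda$-catabolizable, where $\lambda=(\lambda_1,\widehat\lambda)$; the empty tableau is $\varnothing$-catabolizable. For a standard Young tableau $T$ there is a unique maximal (in dominance order) partition $\lambda$ such that $T$ is $\lambda$-catabolizable (a known fact); this $\lambda$ is the catabolizability $\mathrm{ctype}(T)$ of $T$. It is also obtained by repeatedly applying $\mathrm{cat}_m$ with the largest $m$ such that the first $m$ entries of the first row are the $m$ smallest entries of the current tableau, and recording the successive values of $m$. For a standard word $w$, $\mathrm{ctype}(w):=\mathrm{ctype}(P(w))$, and $\mathrm{ctype}(w)_i$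 is its $i$-th part ($0$ if $i$ exceeds the number of parts). *)

(* Defs.v *)
From mathcomp Require Import all_boot all_order all_algebra.
From mathcomp Require Import finmap.
From mathcomp Require Import boolp classical_sets.

Set Implicit Arguments.
Unset Strict Implicit.
Unset Printing Implicit Defensive.

Definition standard_word (w : seq nat) : bool := perm_eq w (iota 1 (size w)).

(* A tableau is the list of its rows, in English notation (top row first). *)
Notation tableau := (seq (seq nat)).

Definition rowword (T : tableau) : seq nat := flatten (rev T).

Fixpoint row_insert (x : nat) (T : tableau) : tableau :=
  if T is r :: T' then
    let i := find (ltn x) r in
    if i < size r then set_nth 0 r i x :: row_insert (nth 0 r i) T'
    else rcons r x :: T'
  else [:: [:: x]].

Definition insertion_tableau (w : seq nat) : tableau :=
  foldl (fun T x => row_insert x T) [::] w.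

(* The index is shifted: this is the label of the letter i.+1 of w. The
   comparison of positions is coerced from bool to nat. *)
Fixpoint cc_label (w : seq nat) (i : nat) : nat :=
  if i is i'.+1 then cc_label w i' + (index i.+1 w < index i w) else 0.

Definition cocharge_labeling (w : seq nat) : seq nat :=
  [seq cc_label w x.-1 | x <- w].

(* With n = size w > 0, the unique m such that 1 <= i + m * n <= n is
   - ((i - 1) %/ n), and then i + m * n = ((i - 1) %% n) + 1; positions in
   seq are counted from 0. Only the values at i <= n matter; they are
   nonnegative. *)
Definition wtilde (w : seq nat) (i : int) : int :=
  let n : int := Posz (size w) in
  (Posz (nth 0%N (cocharge_labeling w) `|((i - 1) %% n)%Z|%N)
     - ((i - 1) %/ n)%Z)%R.

(* The sequence j lists (j_k', ..., j_0), so that j_i is the i-th entry of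
   rev j. *)
Definition is_chain (w : seq nat) (j : seq int) : Prop :=
  let n : int := Posz (size w) in
  [/\ (0 < size j)%N,
      forall x : int, x \in j -> (x <= n)%R,
      sorted (fun x y : int => (x < y)%R) j,
      forall i : nat, (i < size j)%N ->
        wtilde w (nth 0%R (rev j) i) = Posz i
    & uniq [seq (x %% n)%Z | x <- j]].

Definition is_bounded_chain_family (w : seq nat) (k : nat)
    (F : {fset seq int}) : Prop :=
  (forall A : seq int, A \in F -> is_chain w A /\ (size A <= k)%N) /\
  (forall A B : seq int, A \in F -> B \in F -> A <> B ->
     forall a b : int, a \in A -> b \in B ->
       (a %% Posz (size w))%Z <> (b %% Posz (size w))%Z).

Definition family_support (F : {fset seq int}) : {fset int} :=
  (\bigcup_(A <- F) [fset x in A])%fset.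

(* The maximum of the sizes; 0 is a default for when it does not exist. *)
Definition max_family_size (k : nat) (w : seq nat) : nat :=
  xget 0 (fun s : nat =>
    (exists F : {fset seq int},
       is_bounded_chain_family w k F /\ #|` family_support F| = s) /\
    (forall F : {fset seq int},
       is_bounded_chain_family w k F -> #|` family_support F| <= s)).

(* Partitions have weakly decreasing positive parts, without trailing zeros. *)
Definition is_partition (lam : seq nat) : bool :=
  sorted geq lam && (0 \notin lam).

Definition dominated (mu lam : seq nat) : Prop :=
  forall i : nat, sumn (take i mu) <= sumn (take i lam).

Definition catabolism (m : nat) (T : tableau) : tableau :=
  insertion_tableau (drop m (head [::] T) ++ rowword (behead T)).

Fixpoint catabolizable_rec (lam : seq nat) (T : tableau) : bool :=
  if lam is m :: lam' then
    let row := head [::] T in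
    [&& m <= size row,
        all (mem (take m row)) (take m (sort leq (rowword T)))
      & catabolizable_rec lam' (catabolism m T)]
  else T == [::].

(* That the remaining parts form a partition of the size of the catabolism
   follows from the same condition on lam and T, hence need only be required
   at the outset. *)
Definition catabolizable (lam : seq nat) (T : tableau) : bool :=
  [&& is_partition lam, sumn lam == size (rowword T)
    & catabolizable_rec lam T].

(* The maximal element is known to exist and to be unique for a standard
   Young tableau T; [::] is a default. *)
Definition ctype_tableau (T : tableau) : seq nat :=
  xget [::] (fun lam : seq nat =>
    catabolizable lam T /\
    (forall mu : seq nat, catabolizable mu T -> dominated lam mu -> mu = lam)).

Definition ctype (w : seq nat) : seq nat := ctype_tableau (insertion_tableau w).

(* Main.v *)
Require Import Defs.
From mathcomp Require Import all_boot all_order all_algebra.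
From mathcomp Require Import finmap boolp classical_sets.
From mathcomp Require Import zify.

Set Implicit Arguments.
Unset Strict Implicit.
Unset Printing Implicit Defensive.

Import Order.TTheory Num.Theory.

(** Write L for the cocharge label of a letter of w. In a chain of w~, the entry
with value i is an occurrence of a letter shifted by i - L periods, so a chain
is determined by its letters, and consecutive letters a, b may be arbitrary
subject to L(b) <= L(a), or L(b) = L(a) + 1 with b to the left of a. Hence
I_k is the maximal number of letters covered by disjoint paths of at most k
vertices, starting at label 0, in this graph on the letters.

A Knuth transformation preserves L and changes at most one edge of the graph; if
a path uses the edge that disappears, exchanging the witness b of the
transformation with the letter of the same label repairs it. So w may be
replaced by the row word A R B of P(w), where R consists of m letters with label
0 at the start of the first row. Passing to B A, the word of the catabolism,
lowers the labels in A by 1, keeps those in B, and does not change the edges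
between the letters of B A. Prepending the letters of R to at most m paths of
B A gives paths of w, which proves that the sum of the first k parts of lam is at
most I_k whenever P(w) is lam-catabolizable. Conversely, when R contains all the
letters with label 0, cutting paths before these letters and deleting them
gives paths of B A, so taking m maximal at each step yields a partition that
attains I_k for all k, and this partition is ctype(w). *)

(** * Labels, paths and Knuth transformations *)

(** A catabolism removes the smallest letters without renumbering the others, so the alphabet may
    start at any [s]; [s = 1] gives the cocharge labels. *)
Definition label (s : nat) (w : seq nat) (a : nat) : nat :=
  \sum_(s <= i < a) (index i.+1 w < index i w).

Lemma label_recr s w a : s <= a ->
  label s w a.+1 = label s w a + (index a.+1 w < index a w).
Proof. by move=> sa; rewrite /label big_nat_recr. Qed.

Lemma label_base s w : label s w s = 0.
Proof. by rewrite /label big_geq. Qed.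

Lemma leq_label s w a b : s <= a -> a <= b -> label s w a <= label s w b.
Proof.
move=> sa /subnKC <-; elim: (b - a) => [|d IH]; first by rewrite addn0.
by rewrite addnS label_recr; lia.
Qed.

(** The label rises at each letter standing to the left of its predecessor, so equal labels make the
    positions weakly increase from [a] to [b]. *)
Lemma label_eq_index s w a b : s <= a -> a <= b ->
  label s w a = label s w b -> index a w <= index b w.
Proof.
move=> sa /subnKC <-; elim: (b - a) => [|d IH]; first by rewrite addn0.
rewrite addnS label_recr; last lia.
have := @leq_label s w a (a + d) sa (leq_addr _ _).
case: ltnP => /= h le E; first lia.
by apply: leq_trans h; apply: IH; lia.
Qed.

Lemma ltn_label s w a b : s <= a -> a < b -> index b w < index a w ->
  label s w a < label s w b.
Proof.
move=> sa ab h; have := leq_label w sa (ltnW ab); rewrite leq_eqVlt => /orP[/eqP E|//].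
by have := label_eq_index sa (ltnW ab) E; lia.
Qed.

(* A step of a chain of w~ changes the letter read from a to b, and its value
   from i to i.+1: b is then read in an earlier period (when
   label b <= label a), or in the same one, further to the left. *)
Definition arrow (s : nat) (w : seq nat) : rel nat := fun a b =>
  (label s w b <= label s w a) ||
  ((label s w b == (label s w a).+1) && (index b w < index a w)).

(** The first letter is that of j_0, so a path reads a chain backwards. Chains are nonempty, whence
    the value on the empty list. *)
Definition label_path (s : nat) (w p : seq nat) : bool :=
  if p is a :: p' then (label s w a == 0) && path (arrow s w) a p' else false.

Definition path_family (s : nat) (w : seq nat) (k : nat)
    (ps : seq (seq nat)) : bool :=
  [&& all (label_path s w) ps, all (fun p => size p <= k) ps,
      uniq (flatten ps) & all (mem w) (flatten ps)].

Inductive knuth : seq nat -> seq nat -> Prop :=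
| knuth_bac u v a b c : a < b -> b < c ->
    knuth (u ++ [:: b; a; c] ++ v) (u ++ [:: b; c; a] ++ v)
| knuth_acb u v a b c : a < b -> b < c ->
    knuth (u ++ [:: a; c; b] ++ v) (u ++ [:: c; a; b] ++ v)
| knuth_refl w : knuth w w
| knuth_sym w1 w2 : knuth w1 w2 -> knuth w2 w1
| knuth_trans w1 w2 w3 : knuth w1 w2 -> knuth w2 w3 -> knuth w1 w3.

Lemma knuth_perm w1 w2 : knuth w1 w2 -> perm_eq w1 w2.
Proof.
elim=> {w1 w2} [u v a b c _ _|u v a b c _ _|//|w1 w2 _|w1 w2 w3 _ h1 _ h2].
- rewrite perm_cat2l perm_cat2r; apply/permP => f /=; lia.
- rewrite perm_cat2l perm_cat2r; apply/permP => f /=; lia.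
- by rewrite perm_sym.
- exact: perm_trans h1 h2.
Qed.

Lemma knuth_cat l r w1 w2 : knuth w1 w2 -> knuth (l ++ w1 ++ r) (l ++ w2 ++ r).
Proof.
elim=> {w1 w2} [u v a b c h1 h2|u v a b c h1 h2|w|w1 w2 _|w1 w2 w3 _ h1 _ h2].
- by have := knuth_bac (l ++ u) (v ++ r) h1 h2; rewrite -!catA.
- by have := knuth_acb (l ++ u) (v ++ r) h1 h2; rewrite -!catA.
- exact: knuth_refl.
- exact: knuth_sym.
- exact: knuth_trans h1 h2.
Qed.

Lemma index_swap (u v : seq nat) (x y i j : nat) : x != y ->
  ~~ ((i == x) && (j == y)) -> ~~ ((i == y) && (j == x)) ->
  (index i (u ++ [:: x; y] ++ v) < index j (u ++ [:: x; y] ++ v)) =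
  (index i (u ++ [:: y; x] ++ v) < index j (u ++ [:: y; x] ++ v)).
Proof.
move=> xy; rewrite !(index_cat _ u) /=.
case iu: (i \in u); case ju: (j \in u) => //.
- move: iu; rewrite -index_mem => {}iu _ _.
  by rewrite !(leq_trans iu) // leq_addr.
- move: ju; rewrite -index_mem => {}ju _ _.
  by rewrite !ltnNge !(leq_trans (ltnW ju)) // leq_addr.
rewrite !ltn_add2l {iu ju}.
case: (x =P i) => xi; case: (y =P i) => yi;
case: (x =P j) => xj; case: (y =P j) => yj; lia.
Qed.

(** Labels compare only the positions of consecutive integers, and the exchanged letters are not
    consecutive. *)
Lemma label_swap s (u v : seq nat) x y : x.+1 < y ->
  label s (u ++ [:: x; y] ++ v) =1 label s (u ++ [:: y; x] ++ v).
Proof.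
move=> xy a; rewrite /label; apply: eq_bigr => i _.
by rewrite index_swap //; lia.
Qed.

Lemma knuth_label s w1 w2 : knuth w1 w2 -> label s w1 =1 label s w2.
Proof.
elim=> {w1 w2} [u v a b c h1 h2|u v a b c h1 h2|//|w1 w2 _ h x|w1 w2 w3 _ h1 _ h2 x].
- move=> x; have h : a.+1 < c by lia.
  by have := @label_swap s (rcons u b) v a c h x; rewrite -!cats1 -!catA.
- move=> x; have h : a.+1 < c by lia.
  by have := @label_swap s u (b :: v) a c h x.
- by rewrite h.
- by rewrite h1 h2.
Qed.

Definition edges (ps : seq (seq nat)) : seq (nat * nat) :=
  flatten [seq zip p (behead p) | p <- ps].

Lemma path_edges (e : rel nat) a p :
  path e a p = all (fun x => e x.1 x.2) (zip (a :: p) p).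
Proof. by elim: p a => [|b p IH] a //=; rewrite IH. Qed.

Lemma label_pathE s w p : label_path s w p =
  [&& p != [::], label s w (head 0 p) == 0 &
      all (fun x => arrow s w x.1 x.2) (zip p (behead p))].
Proof. by case: p => [|a p] //=; rewrite path_edges. Qed.

(** Separates the first letters from the edges, so that a renaming of letters can be checked edge by
    edge. *)
Lemma all_label_path s w ps : all (label_path s w) ps =
  [&& all (fun p => (p != [::]) && (label s w (head 0 p) == 0)) ps &
      all (fun x => arrow s w x.1 x.2) (edges ps)].
Proof.
rewrite /edges; elim: ps => //= p ps ->; rewrite label_pathE all_cat.
by case: (p != [::]); case: (_ == 0); case: (all _ ps); rewrite ?andbF.
Qed.

Lemma edges_map (f : nat -> nat) ps :
  edges [seq map f p | p <- ps] = [seq (f x.1, f x.2) | x <- edges ps].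
Proof.
rewrite /edges; elim: ps => //= p ps ->; rewrite map_cat; congr (_ ++ _).
by case: p => //= a p; elim: p a => //= b p IH a; rewrite IH.
Qed.

Lemma unzip1_edges ps : subseq (unzip1 (edges ps)) (flatten ps).
Proof.
rewrite /edges; elim: ps => //= p ps IH; rewrite /unzip1 map_cat.
apply: cat_subseq => //; case: p => //= a p.
by elim: p a => //= b p IHp a; rewrite eqxx.
Qed.

Lemma unzip2_edges ps : subseq (unzip2 (edges ps)) (flatten ps).
Proof.
rewrite /edges; elim: ps => //= p ps IH; rewrite /unzip2 map_cat.
apply: cat_subseq => //; case: p => //= a p.
rewrite -/(unzip2 _) unzip2_zip //=; exact: subseq_cons.
Qed.

(** Sources and targets of edges are subsequences of the duplicate-free list of all letters, so a
    letter has at most one successor and one predecessor. *)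
Lemma edges_uniq ps x y x' y' : uniq (flatten ps) ->
  (x, y) \in edges ps -> (x', y') \in edges ps -> (x' == x) = (y' == y).
Proof.
move=> U h h'.
have U1 := subseq_uniq (unzip1_edges ps) U.
have U2 := subseq_uniq (unzip2_edges ps) U.
have inj (f : nat * nat -> nat) e e' : uniq (map f (edges ps)) ->
    e \in edges ps -> e' \in edges ps -> f e = f e' -> e = e'.
  move=> Uf he he' E.
  have hi : index e (edges ps) < size (edges ps) by rewrite index_mem.
  have hi' : index e' (edges ps) < size (edges ps) by rewrite index_mem.
  have := nth_uniq 0 _ _ Uf; rewrite size_map => /(_ _ _ hi hi').
  rewrite !(nth_map e) // !nth_index // E eqxx => /esym /eqP ii.
  by rewrite -(nth_index e he) ii nth_index.
apply/eqP/eqP => E.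
  by have [] : (x, y) = (x', y') by apply: (inj fst).
by have [] : (x, y) = (x', y') by apply: (inj snd).
Qed.

Lemma edges_mem ps x y : (x, y) \in edges ps ->
  (x \in flatten ps) && (y \in flatten ps).
Proof.
move=> h; rewrite (mem_subseq (unzip1_edges ps)); last first.
  by apply/mapP; exists (x, y).
by rewrite (mem_subseq (unzip2_edges ps)) //; apply/mapP; exists (x, y).
Qed.

Lemma path_family_map s w1 w2 k ps (f : nat -> nat) :
  injective f -> {subset w1 <= [pred a | f a \in w2]} ->
  (forall a, a \in w1 -> label s w2 (f a) = label s w1 a) ->
  (forall a b, (a, b) \in edges ps -> arrow s w2 (f a) (f b)) ->
  path_family s w1 k ps -> path_family s w2 k [seq map f p | p <- ps].
Proof.
move=> f_inj fw fl fe /and4P[]; rewrite !all_label_path => /andP[hd _] sz U sub.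
apply/and4P; split.
- rewrite all_label_path edges_map !all_map; apply/andP; split; last first.
    by apply/allP => -[a b] /fe.
  move: hd sub; elim: ps {fe sz U} => //= p ps IH /andP[hp hd].
  rewrite all_cat => /andP[sp sub]; rewrite IH // andbT /=.
  by case: p hp sp => //= a p hp /andP[aw _]; rewrite fl.
- by rewrite all_map; apply: sub_all sz => p /=; rewrite size_map.
- by rewrite -map_flatten map_inj_uniq.
- by rewrite -map_flatten all_map; apply: sub_all sub => a /fw.
Qed.

(** The number of paths is kept too: undoing a catabolism extends only families of at most [m]
    paths. *)
Definition family_transfer s w1 w2 := forall k ps, path_family s w1 k ps ->
  exists ps', [/\ path_family s w2 k ps', size ps' = size ps
                & size (flatten ps') = size (flatten ps)].

Lemma family_transfer_map s w1 w2 :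
  (forall k ps, path_family s w1 k ps -> exists f : nat -> nat,
     [/\ injective f, {subset w1 <= [pred a | f a \in w2]},
      forall a, a \in w1 -> label s w2 (f a) = label s w1 a
     & forall a b, (a, b) \in edges ps -> arrow s w2 (f a) (f b)]) ->
  family_transfer s w1 w2.
Proof.
move=> h k ps fam; have [f [f1 f2 f3 f4]] := h k ps fam.
exists [seq map f p | p <- ps]; split; rewrite ?size_map //.
  exact: path_family_map fam.
by rewrite -map_flatten size_map.
Qed.

Lemma family_edge s w k ps a b : path_family s w k ps -> (a, b) \in edges ps ->
  [/\ a \in w, b \in w, arrow s w a b & a != b].
Proof.
case/and4P; rewrite all_label_path => /andP[_ /allP he] _ U sub ab.
have /andP[ha hb] := edges_mem ab.
split; [exact: (allP sub)|exact: (allP sub)|exact: (he _ ab)|].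
apply/eqP => E; subst b; clear he sub ha hb.
move: ab U; rewrite /edges; elim: ps => //= p ps IH.
rewrite mem_cat cat_uniq => /orP[hp|h] /and3P[Up _ U]; last exact: IH.
move: hp Up {IH U}; case: p => //= x p.
elim: p x => //= y p IH x; rewrite inE => /orP[/eqP[-> ->]|/IH h].
  by rewrite inE eqxx.
by move=> /andP[_ /h].
Qed.

(** An edge along which the label rises needs its target to the left of its source. Moving [c] to
    the left of [a] spoils only such an edge from [c] to [a], and there is none, since the label of
    [a] is at most that of [c]. *)
Lemma family_transfer_swap s (u v : seq nat) a c :
  all (leq s) (u ++ [:: a; c] ++ v) -> a.+1 < c ->
  family_transfer s (u ++ [:: a; c] ++ v) (u ++ [:: c; a] ++ v).
Proof.
move=> hs ac; apply: family_transfer_map => k ps fam; exists id; split => //.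
- by move=> x; rewrite inE /= !mem_cat !inE; case: (x \in u); case: (x == a); case: (x == c).
- by move=> x _; rewrite (label_swap s u v ac).
move=> x y xy; have [xw yw axy _] := family_edge fam xy.
have sa : s <= a by apply: (allP hs); rewrite !mem_cat !inE eqxx orbT.
move: axy; rewrite /arrow -!(label_swap s u v ac) => /orP[-> //|/andP[/eqP l i]].
rewrite l eqxx /=; apply/orP; right.
have [/andP[/eqP xa /eqP yc]|h1] := boolP ((x == a) && (y == c)).
  move: i; subst x y; rewrite !(index_cat _ u) /= !eqxx.
  have -> : a == c = false by lia.
  have -> : c == a = false by lia.
  by case: (a \in u) => //; case: (c \in u) => //; lia.
have [/andP[/eqP xa /eqP yc]|h2] := boolP ((x == c) && (y == a)).
  have := leq_label (u ++ [:: a; c] ++ v) sa (ltnW (ltnW ac)).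
  by move: l; rewrite xa yc; lia.
by rewrite -index_swap //; lia.
Qed.

Lemma index_triple (u v : seq nat) p q r : uniq (u ++ [:: p; q; r] ++ v) ->
  let w := u ++ [:: p; q; r] ++ v in
  [/\ index p w = size u, index q w = size u + 1, index r w = size u + 2 &
      forall x, x != p -> x != q -> x != r -> index x w =
        if x \in u then index x u else size u + 3 + index x v].
Proof.
rewrite cat_uniq => /and3P[_ /= /norP[pu /norP[qu /norP[ru _]]]].
rewrite !inE => /and4P[/norP[pq /norP[pr _]] /norP[qr _] _ _].
rewrite !(index_cat _ u) (negbTE pu) (negbTE qu) (negbTE ru) /= !eqxx.
rewrite (negbTE pq) (negbTE pr) (negbTE qr) addn0; split => // x xp xq xr.
rewrite !(index_cat _ u) /= [p == x]eq_sym [q == x]eq_sym [r == x]eq_sym.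
rewrite (negbTE xp) (negbTE xq) (negbTE xr) -addnA.
by case: (x \in u) => //; lia.
Qed.

Definition transpose (a b x : nat) := if x == a then b else if x == b then a else x.

Lemma transposeK a b : involutive (transpose a b).
Proof.
by move=> x; rewrite /transpose; do ?case: eqP; lia.
Qed.

Lemma transpose_mem a b (w : seq nat) x : a \in w -> b \in w -> x \in w ->
  transpose a b x \in w.
Proof. by rewrite /transpose; case: (x == a); case: (x == b). Qed.

(** Only an edge from [a] to [c] with rising label can be lost. Then [b], standing to the left of
    [a], has a larger label than [a], hence the same label as [c]. Exchanging [b] and [c] in all
    paths keeps the labels and redirects the edge to [b]. *)
Lemma family_transfer_bca s (u v : seq nat) a b c :
  uniq (u ++ [:: b; c; a] ++ v) ->
  all (leq s) (u ++ [:: b; c; a] ++ v) -> a < b -> b < c ->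
  family_transfer s (u ++ [:: b; c; a] ++ v) (u ++ [:: b; a; c] ++ v).
Proof.
set w1 := u ++ _; set w2 := u ++ _ => U hs ab bc.
have kw : knuth w2 w1 by apply: knuth_bac.
have E12 := knuth_perm kw.
have L12 := knuth_label s kw.
have U2 : uniq w2 by rewrite (perm_uniq E12).
have sa : s <= a by apply: (allP hs); rewrite !mem_cat !inE eqxx !orbT.
have [b1 c1 a1 o1] := index_triple U; have [b2 a2 c2 o2] := index_triple U2.
rewrite -/w1 -/w2 in a1 b1 c1 o1 a2 b2 c2 o2.
have bw : b \in w2 by rewrite !mem_cat !inE eqxx !orbT.
have cw : c \in w2 by rewrite !mem_cat !inE eqxx !orbT.
have lab : label s w2 a < label s w2 b by apply: ltn_label; lia.
have lbc : label s w2 b <= label s w2 c by apply: leq_label; lia.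
have oE x : x != b -> x != c -> x != a ->
    index x w1 = index x w2 /\ (index x w2 < size u \/ size u + 2 < index x w2).
  move=> xb xc xa; rewrite o1 // o2 //; split=> //; case: ifP => xu; last lia.
  by left; rewrite index_mem.
apply: family_transfer_map => k ps fam.
have [|h] := boolP (((a, c) \in edges ps) && (label s w2 c == (label s w2 a).+1)).
  case/andP=> ace /eqP lc.
  have lt z : label s w2 (transpose b c z) = label s w2 z.
    have E : label s w2 c = label s w2 b by clear - lc lab lbc; lia.
    by rewrite /transpose; case: eqP => [->|_] //; case: eqP => [->|_].
  exists (transpose b c); split.
  - exact: inv_inj (transposeK b c).
  - by move=> x; rewrite inE /= -(perm_mem E12); apply: transpose_mem.
  - by move=> x _; rewrite -L12 lt.
  move=> x y xy; have [_ _ axy xny] := family_edge fam xy.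
  (* No second edge leaves [a]: one to [b] would be sent to one from [a] to [c], which the new word
     lacks. *)
  have uq : (x == a) = (y == c).
    by apply: edges_uniq ace xy; case/and4P: fam.
  move: axy; rewrite /arrow -!L12 !lt => /orP[-> //|/andP[/eqP l i]].
  (* For each letter, its old position and the new position of its image. *)
  have tE z : let i := index z w1 in let j := index (transpose b c z) w2 in
      [\/ j = i /\ (i < size u \/ size u + 2 < i),
          [/\ z = b, i = size u & j = size u + 2],
          [/\ z = c, i = size u + 1 & j = size u]
        | [/\ z = a, i = size u + 2 & j = size u + 1]].
    rewrite /= /transpose.
    have [-> | zb] := eqVneq z b; first by rewrite b1 c2; apply: Or42.
    have [-> | zc] := eqVneq z c; first by rewrite c1 b2; apply: Or43.
    have [-> | za] := eqVneq z a; first by rewrite a1 a2; apply: Or44.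
    by have [-> ?] := oE z zb zc za; apply: Or41.
  rewrite l eqxx /=; apply/orP; right; clear - ab bc l i uq lc lab lbc xny tE.
  by move: (tE x) (tE y) i => /= [[-> ?]|[ex -> ->]|[ex -> ->]|[ex -> ->]]
     [[-> ?]|[ey -> ->]|[ey -> ->]|[ey -> ->]]; subst; lia.
exists id; split=> //.
- by move=> x; rewrite inE (perm_mem E12).
move=> x y xy; have [_ _ axy xny] := family_edge fam xy.
move: axy; rewrite /arrow -!L12 => /orP[-> //|/andP[/eqP l i]].
rewrite l eqxx /=; apply/orP; right.
have xyac : ~~ ((x == a) && (y == c)).
  apply: contra h => /andP[/eqP <- /eqP <-]; by rewrite xy l eqxx.
have xyca : ~~ ((x == c) && (y == a)).
  by apply/negP => /andP[/eqP xc /eqP ya]; clear - l xc ya lab lbc; subst; lia.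
have ca : c != a by clear - ab bc; lia.
have := @index_swap (rcons u b) v c a y x; rewrite -!cats1 -!catA /= => <- //.
all: by rewrite andbC.
Qed.

(** Now [b] stands to the right of [c] and has a smaller label. If the label rises by one from [a]
    to [c], then [a] and [b] have equal labels, and these two are exchanged. *)
Lemma family_transfer_cab s (u v : seq nat) a b c :
  uniq (u ++ [:: c; a; b] ++ v) ->
  all (leq s) (u ++ [:: c; a; b] ++ v) -> a < b -> b < c ->
  family_transfer s (u ++ [:: c; a; b] ++ v) (u ++ [:: a; c; b] ++ v).
Proof.
set w1 := u ++ _; set w2 := u ++ _ => U hs ab bc.
have kw : knuth w2 w1 by apply: knuth_acb.
have E12 := knuth_perm kw.
have L12 := knuth_label s kw.
have U2 : uniq w2 by rewrite (perm_uniq E12).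
have sa : s <= a by apply: (allP hs); rewrite !mem_cat !inE eqxx !orbT.
have [c1 a1 b1 o1] := index_triple U; have [a2 c2 b2 o2] := index_triple U2.
rewrite -/w1 -/w2 in a1 b1 c1 o1 a2 b2 c2 o2.
have bw : b \in w2 by rewrite !mem_cat !inE eqxx !orbT.
have aw : a \in w2 by rewrite !mem_cat !inE eqxx !orbT.
have lab : label s w2 a <= label s w2 b by apply: leq_label; lia.
have lbc : label s w2 b < label s w2 c by apply: ltn_label; lia.
have oE x : x != b -> x != c -> x != a ->
    index x w1 = index x w2 /\ (index x w2 < size u \/ size u + 2 < index x w2).
  move=> xb xc xa; rewrite o1 // o2 //; split=> //; case: ifP => xu; last lia.
  by left; rewrite index_mem.
apply: family_transfer_map => k ps fam.
have [|h] := boolP (((a, c) \in edges ps) && (label s w2 c == (label s w2 a).+1)).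
  case/andP=> ace /eqP lc.
  have lt z : label s w2 (transpose a b z) = label s w2 z.
    have E : label s w2 b = label s w2 a by clear - lc lab lbc; lia.
    by rewrite /transpose; case: eqP => [->|_] //; case: eqP => [->|_].
  exists (transpose a b); split.
  - exact: inv_inj (transposeK a b).
  - by move=> x; rewrite inE /= -(perm_mem E12); apply: transpose_mem.
  - by move=> x _; rewrite -L12 lt.
  move=> x y xy; have [_ _ axy xny] := family_edge fam xy.
  (* No second edge enters [c]: one from [b] would be sent to one from [a] to [c]. *)
  have uq : (x == a) = (y == c).
    by apply: edges_uniq ace xy; case/and4P: fam.
  move: axy; rewrite /arrow -!L12 !lt => /orP[-> //|/andP[/eqP l i]].
  have tE z : let i := index z w1 in let j := index (transpose a b z) w2 in
      [\/ j = i /\ (i < size u \/ size u + 2 < i),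
          [/\ z = a, i = size u + 1 & j = size u + 2],
          [/\ z = b, i = size u + 2 & j = size u]
        | [/\ z = c, i = size u & j = size u + 1]].
    rewrite /= /transpose.
    have [-> | za] := eqVneq z a; first by rewrite a1 b2; apply: Or42.
    have [-> | zb] := eqVneq z b; first by rewrite b1 a2; apply: Or43.
    have [-> | zc] := eqVneq z c; first by rewrite c1 c2; apply: Or44.
    by have [-> ?] := oE z zb zc za; apply: Or41.
  rewrite l eqxx /=; apply/orP; right; clear - ab bc l i uq lc lab lbc xny tE.
  by move: (tE x) (tE y) i => /= [[-> ?]|[ex -> ->]|[ex -> ->]|[ex -> ->]]
     [[-> ?]|[ey -> ->]|[ey -> ->]|[ey -> ->]]; subst; lia.
exists id; split=> //.
- by move=> x; rewrite inE (perm_mem E12).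
move=> x y xy; have [_ _ axy xny] := family_edge fam xy.
move: axy; rewrite /arrow -!L12 => /orP[-> //|/andP[/eqP l i]].
rewrite l eqxx /=; apply/orP; right.
have xyac : ~~ ((x == a) && (y == c)).
  apply: contra h => /andP[/eqP <- /eqP <-]; by rewrite xy l eqxx.
have xyca : ~~ ((x == c) && (y == a)).
  by apply/negP => /andP[/eqP xc /eqP ya]; clear - l xc ya lab lbc; subst; lia.
have ca : c != a by clear - ab bc; lia.
have := @index_swap u (b :: v) c a y x; rewrite /= => <- //.
all: by rewrite andbC.
Qed.

Lemma knuth_family_transfer s w1 w2 : knuth w1 w2 -> uniq w1 -> all (leq s) w1 ->
  family_transfer s w1 w2 /\ family_transfer s w2 w1.
Proof.
elim=> {w1 w2} [u v a b c h1 h2|u v a b c h1 h2|w|w1 w2 k12 IH|w1 w2 w3 k12 IH1 _ IH2] U hs.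
- have kw := perm_uniq (knuth_perm (knuth_bac u v h1 h2)).
  have kh := perm_all (leq s) (knuth_perm (knuth_bac u v h1 h2)).
  split; last by apply: family_transfer_bca => //; rewrite -?kw -?kh.
  have := @family_transfer_swap s (rcons u b) v a c.
  by rewrite -!cats1 -!catA /=; apply=> //; lia.
- have kw := perm_uniq (knuth_perm (knuth_acb u v h1 h2)).
  have kh := perm_all (leq s) (knuth_perm (knuth_acb u v h1 h2)).
  split; last by apply: family_transfer_cab => //; rewrite -?kw -?kh.
  by apply: (@family_transfer_swap s u (b :: v) a c) => //; lia.
- by split=> k ps fam; exists ps.
- by have [] := IH; rewrite ?(perm_uniq (knuth_perm k12)) ?(perm_all _ (knuth_perm k12)).
- have [t12 t21] := IH1 U hs.
  have [] := IH2; rewrite -?(perm_uniq (knuth_perm k12)) -?(perm_all _ (knuth_perm k12)) //.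
  move=> t23 t32; split=> k ps fam.
    have [ps1 [/t23[ps2 [f2 <- <-]] <- <-]] := t12 _ _ fam.
    by exists ps2.
  have [ps1 [/t21[ps2 [f2 <- <-]] <- <-]] := t32 _ _ fam.
  by exists ps2.
Qed.

(** * Row insertion *)

Definition above (r r' : seq nat) : bool :=
  (size r' <= size r) && all (fun i => nth 0 r i < nth 0 r' i) (iota 0 (size r')).

Lemma aboveP r r' : reflect
  (size r' <= size r /\ forall i, i < size r' -> nth 0 r i < nth 0 r' i)
  (above r r').
Proof.
apply: (iffP andP) => -[h1 h2]; split=> //.
  by move=> i hi; apply: (allP h2); rewrite mem_iota.
by apply/allP => i; rewrite mem_iota add0n => /h2.
Qed.

Fixpoint syt (T : tableau) : bool :=
  if T is r :: T' then
    [&& r != [::], sorted ltn r, above r (head [::] T') & syt T']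
  else true.

Lemma rowword_cons r T : rowword (r :: T) = rowword T ++ r.
Proof. by rewrite /rowword rev_cons flatten_rcons. Qed.

Lemma nth_ltn_sorted r i j : sorted ltn r -> i < j -> j < size r ->
  nth 0 r i < nth 0 r j.
Proof.
move=> hs ij jr.
by have /= := sorted_ltn_nth ltn_trans 0 hs => -> //; rewrite !inE; lia.
Qed.

Lemma find_ltn_split (x : nat) (r : seq nat) : sorted ltn r -> x \notin r ->
  let i := find (ltn x) r in
  all (gtn x) (take i r) /\ (i < size r -> x < nth 0 r i).
Proof.
move=> hs xr i; split; last by move=> h; apply: (@nth_find _ 0 (ltn x)); rewrite has_find.
apply/allP => z /(nthP 0)[j]; rewrite size_take => jr <-.
have ji : j < i by move: jr; case: ifP; lia.
have jr' : j < size r by have := find_size (ltn x) r; rewrite -/i; lia.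
rewrite nth_take //.
have := before_find 0 ji; have : nth 0 r j != x.
  by apply: contra xr => /eqP <-; rewrite mem_nth.
by rewrite /=; lia.
Qed.

Lemma sorted_set_nth (r : seq nat) (x : nat) : sorted ltn r -> x \notin r ->
  find (ltn x) r < size r -> sorted ltn (set_nth 0 r (find (ltn x) r) x).
Proof.
move=> hs xr hi; have [/allP h1 /(_ hi) h2] := find_ltn_split hs xr.
set i := find _ _ in hi h1 h2 *.
have ez : size (set_nth 0 r i x) = size r by rewrite size_set_nth; lia.
apply/(sortedP 0) => j; rewrite ez => hj; rewrite !nth_set_nth /=.
case: eqP => [ji|_]; case: eqP => [ji'|_]; try lia.
- have : nth 0 r i < nth 0 r j.+1 by apply: nth_ltn_sorted; lia.
  by lia.
- have := h1 (nth 0 r j); rewrite /=; apply.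
  by apply/(nthP 0); exists j; rewrite ?nth_take ?size_takel ?ji' -?ji' //; exact: ltnW.
- by apply: nth_ltn_sorted.
Qed.

Lemma sorted_rcons_max (r : seq nat) (x : nat) : sorted ltn r -> x \notin r ->
  size r <= find (ltn x) r -> sorted ltn (rcons r x).
Proof.
move=> hs xr hi; have [h1 _] := find_ltn_split hs xr.
move: h1; rewrite take_oversize // => h1.
case: r hs h1 {hi xr} => //= a r hs /andP[ax h1].
rewrite rcons_path hs /=; case: (lastP r) h1 ax => //= r' z.
by rewrite all_rcons last_rcons => /andP[].
Qed.

(** The bumped entry moves weakly left, because the entry below its old place exceeds it, and in
    those columns the upper row is smaller than it. Elsewhere the upper row has not increased. *)
Lemma above_insert (r : seq nat) (x : nat) T : sorted ltn r -> x \notin r ->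
  syt T -> above r (head [::] T) ->
  {in rowword T, forall y, y \notin r} ->
  let i := find (ltn x) r in
  i < size r -> above (set_nth 0 r i x) (head [::] (row_insert (nth 0 r i) T)).
Proof.
move=> hs xr; case: T => [|r2 T] hT hab hd i hi.
  have [_ /(_ hi) h2] := find_ltn_split hs xr.
  apply/aboveP; split=> /=; first by rewrite size_set_nth; lia.
  case=> //= _; rewrite nth_set_nth /=; case: eqP => [e|ne]; first exact: h2.
  by apply: nth_ltn_sorted => //; rewrite -/i; lia.
have [_ /(_ hi) h2] := find_ltn_split hs xr; rewrite -/i in h2.
set y := nth 0 r i in h2 *.
have /aboveP[/= sz hn] := hab.
have {hT}/and4P[_ hs2 _ _] := hT.
have yr2 : y \notin r2.
  apply/negP => yr2; have := hd y; rewrite rowword_cons mem_cat yr2 orbT.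
  by rewrite mem_nth // => /(_ isT).
have [j1 j2] := find_ltn_split hs2 yr2.
have ji : find (ltn y) r2 <= i.
  have [i2|i2] := leqP (size r2) i; first by have := find_size (ltn y) r2; lia.
  rewrite leqNgt; apply/negP => /(before_find 0) /=.
  by rewrite hn.
have nj : forall j l, j <= i -> l < size r -> nth 0 (set_nth 0 r i x) l <= nth 0 r l.
  move=> j l _ _; rewrite nth_set_nth /=; case: eqP => [->|//]; exact: ltnW.
have nij j : j <= i -> nth 0 (set_nth 0 r i x) j < y.
  rewrite nth_set_nth /=; case: eqP => [//|ne] le.
  by apply: nth_ltn_sorted => //; lia.
rewrite /=; set j := find (ltn y) r2 in j1 j2 ji *.
case: ifP => jr /=; apply/aboveP; rewrite ?size_set_nth ?size_rcons.
  split; first lia.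
  move=> l hl; rewrite [ltnRHS]nth_set_nth /=; case: eqP => [->|ne]; first exact: nij.
  have lr : l < size r2 by lia.
  by apply: leq_ltn_trans (nj i l _ _) (hn l lr); lia.
have jr2 : j = size r2 by have := find_size (ltn y) r2; rewrite -/j; lia.
split; first lia.
move=> l hl; rewrite nth_rcons.
case: (ltngtP l (size r2)) => [lr|//|->]; [|lia|by apply: nij; lia].
by apply: leq_ltn_trans (nj i l _ _) (hn l lr); lia.
Qed.

Lemma above_size r r' T : size r <= size r' -> (forall i, i < size r -> nth 0 r' i = nth 0 r i) ->
  above r T -> above r' T.
Proof.
move=> sz hn /aboveP[h1 h2]; apply/aboveP; split; first exact: leq_trans sz.
by move=> i hi; rewrite hn ?h2 //; lia.
Qed.

Lemma row_insert_perm x T : perm_eq (rowword (row_insert x T)) (x :: rowword T).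
Proof.
elim: T x => [|r T IH] x //=; case: ifP => hi; rewrite !rowword_cons; last first.
  by rewrite -cats1 catA perm_catC.
apply: perm_trans (perm_cat (IH _) (perm_refl _)) _.
rewrite set_nthE hi /= -[in X in perm_eq _ X](cat_take_drop (find (ltn x) r) r).
rewrite [in X in perm_eq _ X](drop_nth 0 hi).
apply/permP => f /=; rewrite !count_cat /=; lia.
Qed.

Lemma syt_row_insert x T : syt T -> uniq (x :: rowword T) -> syt (row_insert x T).
Proof.
elim: T x => [|r T IH] x //= /and4P[rn hs hab hT].
rewrite rowword_cons mem_cat negb_or cat_uniq => /andP[/andP[xT xr] /and3P[UT /hasPn dj Ur]].
case: ifP => hi /=; last first.
  rewrite sorted_rcons_max ?hT ?andbT //; last by lia.
  apply/andP; split; first by case: r {rn hs hab xr dj Ur hi}.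
  apply: above_size hab; rewrite ?size_rcons // => i ir.
  by rewrite nth_rcons ir.
rewrite sorted_set_nth // above_insert //=; last first.
  by move=> y yT; apply/negP => /dj; rewrite /= yT.
apply/andP; split.
  by apply/eqP => /(congr1 size); rewrite size_set_nth /=; lia.
apply: IH => //=; rewrite UT andbT; apply: dj; exact: mem_nth.
Qed.

Lemma insertion_tableau_rcons w x :
  insertion_tableau (rcons w x) = row_insert x (insertion_tableau w).
Proof. by rewrite /insertion_tableau -cats1 foldl_cat. Qed.

Lemma insertion_tableau_perm w : perm_eq (rowword (insertion_tableau w)) w.
Proof.
elim/last_ind: w => // w x IH; rewrite insertion_tableau_rcons.
rewrite (perm_trans (row_insert_perm _ _)) // perm_sym perm_rcons perm_cons.
by rewrite perm_sym.
Qed.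

Lemma syt_insertion_tableau w : uniq w -> syt (insertion_tableau w).
Proof.
elim/last_ind: w => // w x IH; rewrite rcons_uniq => /andP[xw U].
rewrite insertion_tableau_rcons; apply: syt_row_insert; first exact: IH.
by rewrite /= (perm_mem (insertion_tableau_perm w)) xw (perm_uniq (insertion_tableau_perm w)).
Qed.

(** The letter [x] moves left past the letters of [v] one by one; the witness is the letter before
    the one passed. *)
Lemma knuth_shift_small v x y : x < y -> sorted ltn (y :: v) ->
  knuth (y :: rcons v x) (y :: x :: v).
Proof.
move=> xy; elim/last_ind: v => [|v z IH] hs; first exact: knuth_refl.
have hsv : sorted ltn (y :: v) by move: hs; rewrite /= rcons_path => /andP[].
have lz : last y v < z by move: hs; rewrite /= rcons_path => /andP[].
have xl : x < last y v.
  case: (lastP v) hsv {IH hs lz} => [//|v' t] hsv; rewrite last_rcons.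
  apply: ltn_trans xy _; move: hsv => /= /(order_path_min ltn_trans) /allP; apply.
  by rewrite mem_rcons inE eqxx.
apply: (@knuth_trans _ (y :: rcons (rcons v x) z)).
  have [u e] : exists u, y :: v = rcons u (last y v).
    by exists (belast y v); rewrite lastI.
  rewrite -!cats1 -!catA /= -!cat_cons e -!cats1 -!catA.
  apply: knuth_sym; exact: (knuth_bac u [::] xl lz).
by have := knuth_cat [::] [:: z] (IH hsv); rewrite /= !cats1.
Qed.

(** The letter [y] moves left past the letters of [u] one by one; the witness is its right
    neighbour, at first [x], then the letter passed last. *)
Lemma knuth_shift_large u x y : x < y -> sorted ltn (rcons u x) ->
  knuth (u ++ [:: y; x]) (y :: rcons u x).
Proof.
elim/last_ind: u x => [|u a IH] x xy hs; first exact: knuth_refl.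
have [hsu ax] : sorted ltn (rcons u a) /\ a < x.
  move: hs; case: u {IH} => [|b u] /=; first by rewrite andbT.
  by rewrite rcons_path last_rcons => /andP[].
apply: (@knuth_trans _ ((u ++ [:: y; a]) ++ [:: x])).
  by have := knuth_acb u [::] ax xy; rewrite -!cats1 -!catA.
have := knuth_cat [::] [:: x] (IH a (ltn_trans ax xy) hsu).
by rewrite /= -[rcons (rcons u a) x]cats1.
Qed.

(** Within a row, [x] moves left until it stands just behind the entry [y] that it bumps; then [y]
    moves to the front of the row, ready for insertion into the rows below. *)
Lemma knuth_row_insert x T : syt T -> uniq (x :: rowword T) ->
  knuth (rcons (rowword T) x) (rowword (row_insert x T)).
Proof.
elim: T x => [|r T IH] x /=; first by move=> *; exact: knuth_refl.
move=> /and4P[rn hs hab hT].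
rewrite rowword_cons mem_cat negb_or cat_uniq => /andP[/andP[xT xr] /and3P[UT /hasPn dj Ur]].
case: ifP => hi; rewrite rowword_cons; last by rewrite rcons_cat; exact: knuth_refl.
have [h1 /(_ hi) h2] := find_ltn_split hs xr.
have hss := sorted_set_nth hs xr hi.
set i := find _ _ in hi h1 h2 hss *; set y := nth 0 r i in h2 *.
have yT : y \notin rowword T by apply: dj; exact: mem_nth.
have := IH y hT; rewrite /= yT UT => /(_ isT) kT.
apply: knuth_trans (knuth_cat [::] (set_nth 0 r i x) kT).
rewrite /= rcons_cat cat_rcons.
have := @knuth_cat (rowword T) [::] (rcons r x) (y :: set_nth 0 r i x).
rewrite !cats0; apply.
move: hss; rewrite set_nthE hi -[in X in knuth X](cat_take_drop i r) (drop_nth 0 hi) -/y => hss.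
rewrite rcons_cat rcons_cons.
apply: (@knuth_trans _ (take i r ++ [:: y, x & drop i.+1 r])).
  have := @knuth_cat (take i r) [::] (y :: rcons (drop i.+1 r) x).
  move=> /(_ (y :: x :: drop i.+1 r)); rewrite !cats0; apply.
  apply: knuth_shift_small => //; rewrite -(drop_nth 0 hi).
  exact: (drop_sorted i hs).
have := @knuth_cat [::] (drop i.+1 r) (take i r ++ [:: y; x]) (y :: rcons (take i r) x).
rewrite /= -catA cat_rcons; apply; apply: knuth_shift_large => //.
move: hss; rewrite -cat_rcons => /cat_sorted2[]//.
Qed.

Lemma knuth_insertion_tableau w : uniq w -> knuth w (rowword (insertion_tableau w)).
Proof.
elim/last_ind: w => [|w x IH]; first by move=> _; exact: knuth_refl.
rewrite rcons_uniq => /andP[xw U]; rewrite insertion_tableau_rcons.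
have p := insertion_tableau_perm w.
apply: (@knuth_trans _ (rcons (rowword (insertion_tableau w)) x)).
  by have := knuth_cat [::] [:: x] (IH U); rewrite /= !cats1.
apply: knuth_row_insert; first exact: syt_insertion_tableau.
by rewrite /= (perm_mem p) xw (perm_uniq p).
Qed.

(** * Paths under catabolism *)

Section Catabolism.

Variables (A B : seq nat) (s m n : nat).
Let w0 := A ++ iota s m ++ B.
Let w1 := B ++ A.
Hypothesis w0_perm : perm_eq w0 (iota s n).

Lemma catabolism_uniq : [/\ uniq A, uniq B, {in A, forall a, a \notin B} &
  forall j, j < m -> (s + j \notin A) && (s + j \notin B)].
Proof.
have := perm_uniq w0_perm; rewrite iota_uniq !cat_uniq => /and3P[UA dA].
case/and3P=> _ dB UB; split=> //.
  move=> a aA; apply/negP => aB; move/hasP: dA; apply.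
  by exists a => //; rewrite mem_cat aB orbT.
move=> j jm; have ji : s + j \in iota s m by rewrite mem_iota; lia.
apply/andP; split; apply/negP => h.
  by move/hasP: dA; apply; exists (s + j); rewrite // mem_cat ji.
by move/hasP: dB; apply; exists (s + j).
Qed.

Lemma catabolism_size : n = size A + m + size B.
Proof.
have : size w0 = size (iota s n) := perm_size w0_perm.
by rewrite /w0 !size_cat !size_iota; lia.
Qed.

Lemma mem_catabolism a : a \in w1 = (s + m <= a < s + n).
Proof.
have := perm_mem w0_perm a; have [_ _ _ dj] := catabolism_uniq.
rewrite !mem_cat !mem_iota; have := catabolism_size.
have [am|am] := leqP (s + m) a; first by case: (a \in A); case: (a \in B); lia.
have [sa|sa] := leqP s a; last by case: (a \in A); case: (a \in B); lia.
move: (dj (a - s)); rewrite subnKC //; case: (a \in A); case: (a \in B); lia.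
Qed.

Lemma catabolism_perm : perm_eq w1 (iota (s + m) (n - m)).
Proof.
have [UA UB dAB _] := catabolism_uniq.
apply: uniq_perm; rewrite ?iota_uniq //.
  by rewrite cat_uniq UA UB andbT; apply/hasPn => a /dAB.
move=> a; rewrite mem_catabolism mem_iota; have := catabolism_size; lia.
Qed.

Lemma mem_uncatabolized a : a \in w0 -> a \notin iota s m -> a \in w1.
Proof. by rewrite !mem_cat; case: (a \in A); case: (a \in B); case: (a \in iota s m). Qed.

(** Passing from [w0] to [w1] keeps the order of two letters of the same factor and reverses it for
    letters of different factors. *)
Lemma index_catabolism a : a \in w1 ->
  [\/ [/\ a \in A, index a w0 < size A & index a w1 = size B + index a w0]
    | [/\ a \notin A, index a w1 < size B & index a w0 = size A + m + index a w1]].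
Proof.
have [_ _ dAB _] := catabolism_uniq.
rewrite mem_cat !(index_cat _ A) !(index_cat _ B) => /orP[aB|aA].
  have aA : a \notin A by apply/negP => /dAB; rewrite aB.
  right; rewrite aB (negbTE aA) index_mem; split=> //.
  rewrite index_cat size_iota -addnA ifN // mem_iota.
  have : a \in w1 by rewrite mem_cat aB.
  by rewrite mem_catabolism; lia.
by left; rewrite aA (negbTE (dAB _ aA)) index_mem.
Qed.

Lemma index_catabolized j : j < m -> index (s + j) w0 = size A + j.
Proof.
move=> jm; have [_ _ _ /(_ j jm)/andP[jA _]] := catabolism_uniq.
rewrite index_cat (negbTE jA) index_cat mem_iota leq_addr ltn_add2l jm.
congr (_ + _); have := @index_uniq _ 0 j (iota s m).
by rewrite size_iota iota_uniq nth_iota // => ->.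
Qed.

Lemma label_catabolized j : j < m -> label s w0 (s + j) = 0.
Proof.
elim: j => [|j IH] jm; first by rewrite addn0 label_base.
rewrite addnS label_recr; last lia.
by rewrite IH -?addnS ?index_catabolized //; lia.
Qed.

Hypothesis m_gt0 : 0 < m.

(** Induction on the letter. The letter [s + m] is compared with the last letter of the run and
    stands to its left exactly when it is in [A]. Later, crossing between [A] and [B] changes the
    increment by one, which the membership in [A] compensates. *)
Lemma label_catabolism a : a \in w1 ->
  label s w0 a = label (s + m) w1 a + (a \in A).
Proof.
rewrite mem_catabolism => /andP[/subnKC <-]; elim: (a - _) => [|d IH] dn.
  rewrite addn0 label_base add0n.
  have e : s + m = (s + m.-1).+1 by lia.
  rewrite {1}e label_recr; last lia.
  rewrite label_catabolized; last lia.
  rewrite -e (@index_catabolized m.-1); last lia.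
  have : s + m \in w1 by rewrite mem_catabolism; lia.
  case/index_catabolism => -[sA h1 h2].
    by rewrite sA; move: h1; case: ltnP; lia.
  by rewrite (negbTE sA) h2; case: ltnP; lia.
rewrite addnS !label_recr; [|lia|lia].
have hd : s + m + d \in w1 by rewrite mem_catabolism; lia.
have hd1 : (s + m + d).+1 \in w1 by rewrite mem_catabolism; lia.
rewrite IH; last lia.
case: (index_catabolism hd) => -[]; case: (index_catabolism hd1) => -[].
- by move=> -> h1 h2 -> h3 h4; lia.
- by move=> /negbTE -> h1 h2 -> h3 h4; lia.
- by move=> -> h1 h2 /negbTE -> h3 h4; lia.
- by move=> /negbTE -> h1 h2 /negbTE -> h3 h4; lia.
Qed.

(** For [a] in [A] and [b] in [B], both sides say that in [w1] the label of [b] is at most one more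
    than that of [a]; for [a] in [B] and [b] in [A], that it is at most that of [a]. *)
Lemma arrow_catabolism a b : a \in w1 -> b \in w1 ->
  arrow s w0 a b = arrow (s + m) w1 a b.
Proof.
move=> aw bw; rewrite /arrow !label_catabolism //.
case: (index_catabolism aw) => -[]; case: (index_catabolism bw) => -[].
- by move=> -> h1 h2 -> h3 h4; lia.
- by move=> /negbTE -> h1 h2 -> h3 h4; lia.
- by move=> -> h1 h2 /negbTE -> h3 h4; lia.
- by move=> /negbTE -> h1 h2 /negbTE -> h3 h4; lia.
Qed.

Lemma path_catabolism a p : all (mem w1) (a :: p) ->
  path (arrow s w0) a p = path (arrow (s + m) w1) a p.
Proof.
elim: p a => //= b p IH a /and3P[aw bw pw].
by rewrite IH /= ?bw // arrow_catabolism.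
Qed.

(** Any letter of the run may precede a path of [w1]: in [w0] the first letter of the path has label
    0 if it is in [B], and if it is in [A] it has label 1 and stands to the left of the run. *)
Lemma path_family_grow k ps : size ps <= m -> path_family (s + m) w1 k ps ->
  exists ps', [/\ path_family s w0 k.+1 ps', size ps' = m
                & size (flatten ps') = m + size (flatten ps)].
Proof.
move=> sz /and4P[lp lk U sub].
(* The default [[::]] turns the remaining letters of the run into one-letter paths, so that all [m]
   are covered. *)
pose f j := (s + j) :: nth [::] ps j.
have Ew0 x : (x \in w0) = (s <= x < s + n).
  by rewrite (perm_mem w0_perm) mem_iota.
have mn := catabolism_size.
have shape : perm_eq (flatten [seq f j | j <- iota 0 m]) (iota s m ++ flatten ps).
  apply/permP => g; rewrite count_cat count_flatten -map_comp.
  have -> : iota s m = [seq s + j | j <- iota 0 m] by rewrite -iotaDl addn0.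
  rewrite count_map -sum1_count big_mkcond /= sumnE big_map.
  (* Indexing [ps] by the range used for the new paths lets the counts be compared term by term. *)
  rewrite [in RHS](_ : ps = [seq nth [::] ps j | j <- iota 0 m & j < size ps]); last first.
    have -> : [seq j <- iota 0 m | j < size ps] = iota 0 (size ps).
      rewrite -(subnKC sz) iotaD filter_cat add0n.
      rewrite (all_filterP (_ : all _ (iota 0 _))); last by apply/allP => j; rewrite mem_iota; lia.
      rewrite (@eq_in_filter _ _ pred0) ?filter_pred0 ?cats0 // => j.
      by rewrite mem_iota /=; lia.
    by rewrite -/(mkseq (nth [::] ps) (size ps)) mkseq_nth.
  rewrite count_flatten -map_comp sumnE big_map big_filter [X in _ + X]big_mkcond -big_split /=.
  apply: eq_bigr => j _; rewrite /=; congr (_ + _).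
  by case: ltnP => // h; rewrite nth_default.
have szf : size (flatten [seq f j | j <- iota 0 m]) = m + size (flatten ps).
  by rewrite (perm_size shape) size_cat size_iota.
exists [seq f j | j <- iota 0 m]; split=> //; last by rewrite size_map size_iota.
apply/and4P; split.
- apply/allP => _ /mapP[j + ->]; rewrite mem_iota => /= jm.
  rewrite label_catabolized //=.
  have [jp|jp] := leqP (size ps) j; first by rewrite nth_default.
  have /(allP lp) : nth [::] ps j \in ps by exact: mem_nth.
  have : all (mem w1) (nth [::] ps j).
    apply/allP => x xp; apply: (allP sub); apply/flattenP.
    by exists (nth [::] ps j); rewrite ?mem_nth.
  case: (nth [::] ps j) => //= a p apw /andP[/eqP la].
  rewrite -path_catabolism // => ->; rewrite andbT /arrow.
  case/andP: apw => aw _.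
  rewrite label_catabolized // label_catabolism // la.
  case: (index_catabolism aw) => -[aA h1 h2]; last by rewrite (negbTE aA).
  by rewrite aA /= index_catabolized //; lia.
- apply/allP => _ /mapP[j _ ->] /=; rewrite ltnS.
  have [jp|jp] := leqP (size ps) j; first by rewrite nth_default.
  by apply: (allP lk); exact: mem_nth.
- rewrite (perm_uniq shape) cat_uniq iota_uniq U andbT /=.
  apply/hasPn => x /(allP sub); rewrite /= mem_catabolism mem_iota; lia.
- rewrite (perm_all _ shape) all_cat; apply/andP; split; apply/allP => x /=.
    by rewrite mem_iota Ew0; lia.
  by move/(allP sub); rewrite /= mem_catabolism Ew0; lia.
Qed.

Hypothesis m_max : n = m \/ s + m \in A.

(** If [s + m] is in [A], its label is 1, and labels never decrease from there on. *)
Lemma label_catabolized_eq0 a : a \in w0 -> (label s w0 a == 0) = (a \in iota s m).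
Proof.
rewrite (perm_mem w0_perm) !mem_iota => an.
have [am|am] := ltnP a (s + m).
  have e : a = s + (a - s) by lia.
  by rewrite e label_catabolized; lia.
case: m_max => [|smA]; first lia.
have : s + m \in w1 by rewrite mem_cat smA orbT.
move/label_catabolism; rewrite smA label_base => l1.
by have := @leq_label s w0 (s + m) a (leq_addr _ _) am; lia.
Qed.

(** The first letter of [q] is outside the run, so its label is nonzero; the arrow from [b] makes it
    1 and puts the letter to the left of [b]. Hence the letter is in [A] and its label drops to
    0. *)
Lemma label_path_catabolism b q : b \in iota s m -> all (mem w1) q -> q != [::] ->
  path (arrow s w0) b q -> label_path (s + m) w1 q.
Proof.
case: q => // x q; rewrite mem_iota => /andP[sb bm] subq _ /= /andP[bx].
rewrite path_catabolism // => ->; rewrite andbT.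
have xw1 : x \in w1 by case/andP: subq.
have bE : s + (b - s) = b by rewrite subnKC.
have bm' : b - s < m by rewrite -(ltn_add2l s) bE.
have xm : (x \in iota s m) = false.
  apply/negbTE; move: xw1; rewrite mem_catabolism mem_iota => /andP[h1 _].
  by rewrite negb_and -leqNgt h1 orbT.
have xw0 : x \in w0.
  by move: xw1; rewrite !mem_cat orbC => /orP[] ->; rewrite ?orbT.
move: bx; rewrite /arrow -bE label_catabolized // index_catabolized // leqn0.
rewrite label_catabolized_eq0 // xm /= label_catabolism // => /andP[/eqP].
by case: (index_catabolism xw1) => -[xA h1 h2]; rewrite ?xA ?(negbTE xA); lia.
Qed.

(* A path is cut just before each letter with label 0, and these letters are
   deleted: a letter with nonzero label preceded by one with label 0 gets label
   0 after the catabolism. *)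
Lemma path_cut a p : all (mem w0) p -> path (arrow s w0) a p ->
  exists q qs, [/\ filter [predC iota s m] p = q ++ flatten qs,
    path (arrow s w0) a q, all (label_path (s + m) w1) qs,
    size q <= size p & all (fun q => size q <= size p) qs].
Proof.
elim: p a => [|b p IH] a; first by exists [::], [::].
move=> /= /andP[bw sub] /andP[ab bp].
have [q [qs [e pq lq sq sqs]]] := IH b sub bp.
have sqs' : all (fun q => size q <= (size p).+1) qs.
  by apply: sub_all sqs => x; exact: leqW.
case: ifP => hb; last first.
  (* Here [b] is deleted, and what was collected after it, if anything, becomes a path of its
     own. *)
  move/negbFE: hb => hb; case: q e pq sq => [|x q] e pq sq.
    by exists [::], qs; split.
  exists [::], ((x :: q) :: qs); split=> //; last by rewrite /= sqs' ltnW.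
  apply/andP; split=> //; apply: label_path_catabolism hb _ _ pq => //.
  apply/allP => y yq; have : y \in filter [predC iota s m] p.
    by rewrite e mem_cat yq.
  by rewrite mem_filter => /andP[ym /(allP sub) yw]; exact: mem_uncatabolized.
by exists (b :: q), qs; split=> //=; rewrite ?e // ab.
Qed.

(** The first letter has label 0, so it is in the run and is deleted. Every piece is therefore
    strictly shorter, which lowers the bound [k.+1] to [k]. *)
Lemma label_path_cut p : all (mem w0) p -> label_path s w0 p ->
  exists qs, [/\ filter [predC iota s m] p = flatten qs,
    all (label_path (s + m) w1) qs & all (fun q => size q < size p) qs].
Proof.
case: p => // a p /= /andP[aw sub] /andP[la pa].
have [q [qs [e pq lq sq sqs]]] := path_cut sub pa.
rewrite -label_catabolized_eq0 // la /=.
have am : a \in iota s m by rewrite -label_catabolized_eq0.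
case: q e pq sq => [|x q] e pq sq; first by exists qs.
exists ((x :: q) :: qs); split=> //; last by rewrite /= ltnS sq.
apply/andP; split=> //; apply: label_path_catabolism am _ _ pq => //.
apply/allP => y yq; have : y \in filter [predC iota s m] p.
  by rewrite e mem_cat yq.
by rewrite mem_filter => /andP[ym /(allP sub) yw]; exact: mem_uncatabolized.
Qed.

Lemma path_family_cut k ps : path_family s w0 k.+1 ps ->
  exists ps', path_family (s + m) w1 k ps' /\
              size (flatten ps) <= m + size (flatten ps').
Proof.
case/and4P=> lp lk U sub.
have [ps' [e lp' lk']] : exists ps', [/\
    filter [predC iota s m] (flatten ps) = flatten ps',
    all (label_path (s + m) w1) ps' & all (fun p => size p <= k) ps'].
  elim: ps lp lk sub {U} => [|p ps IH]; first by exists [::].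
  rewrite /= all_cat => /andP[pp lp] /andP[pk lk] /andP[psub sub].
  have [qs [e1 lq sq]] := label_path_cut psub pp.
  have [ps' [e2 lp' lk']] := IH lp lk sub.
  exists (qs ++ ps'); rewrite filter_cat flatten_cat e1 e2 !all_cat lq lp' lk' !andbT.
  by split=> //; apply: sub_all sq => q h; rewrite -ltnS (leq_trans h).
exists ps'; split.
  apply/and4P; split=> //; rewrite -e; first exact: filter_uniq.
  apply/allP => y.
  by rewrite mem_filter => /andP[ym /(allP sub) yw]; exact: mem_uncatabolized.
(* The deleted letters are distinct letters of the run, hence at most [m]. *)
rewrite -e size_filter -(count_predC (mem (iota s m)) (flatten ps)) leq_add2r.
rewrite -size_filter -[X in _ <= X](size_iota s).
apply: uniq_leq_size; first exact: filter_uniq.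
by move=> y; rewrite mem_filter => /andP[].
Qed.

End Catabolism.

(** * Catabolizability and families of paths *)

Lemma sorted_iota_prefix (r : seq nat) s m : sorted ltn r -> m <= size r ->
  {subset iota s m <= take m r} -> take m r = iota s m.
Proof.
move=> hs mr sub; have st : sorted ltn (take m r) by exact: take_sorted.
apply: (irr_sorted_eq ltn_trans ltnn) => //; first exact: iota_ltn_sorted.
have [] := uniq_min_size (iota_uniq s m) sub.
  by rewrite size_iota size_takel.
by move=> _ e x; rewrite e.
Qed.

Lemma catabolizable_first_row w s n m lam : perm_eq w (iota s n) -> 0 < m ->
  catabolizable_rec (m :: lam) (insertion_tableau w) ->
  exists r T, insertion_tableau w = r :: T /\ take m r = iota s m.
Proof.
move=> hw m0 /= /and3P[mr /allP hall _].
have Tp : perm_eq (rowword (insertion_tableau w)) (iota s n).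
  exact: perm_trans (insertion_tableau_perm w) hw.
have ST : syt (insertion_tableau w).
  by apply: syt_insertion_tableau; rewrite (perm_uniq hw) iota_uniq.
have es : sort leq (rowword (insertion_tableau w)) = iota s n.
  apply: (sorted_eq leq_trans anti_leq).
  - exact: (sort_sorted leq_total).
  - exact: iota_sorted.
  - by rewrite perm_sort.
rewrite es in hall.
case: (insertion_tableau w) mr hall Tp ST {es} => [|r T] /=; first lia.
move=> mr hall Tp /and4P[_ rs _ _].
exists r, T; split=> //; apply: sorted_iota_prefix => // x xm.
apply: hall; rewrite take_iota; suff /minn_idPl -> : m <= n by [].
have : size (rowword (r :: T)) = size (iota s n) := perm_size Tp.
by rewrite rowword_cons size_cat size_iota; lia.
Qed.

(** Catabolisms are undone one at a time. The bound [c] stands for the part removed before: since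
    parts weakly decrease, there are never more paths than letters to put in front of them. *)
Lemma catabolizable_family lam w s n k c : perm_eq w (iota s n) ->
  sorted geq (c :: lam) -> 0 \notin lam ->
  catabolizable_rec lam (insertion_tableau w) ->
  exists ps, [/\ path_family s w k ps, size ps <= c
               & size (flatten ps) = sumn (take k lam)].
Proof.
elim: lam w s n k c => [|m lam IH] w s n [|k] c hw; try by exists [::].
move=> /= /andP[mc slam]; rewrite inE negb_or => /andP[m0 l0] hcat.
have {}m0 : 0 < m by lia.
have [r [T [eT er]]] := catabolizable_first_row hw m0 hcat.
case/and3P: hcat => _ _; rewrite eT /catabolism /= => hcat.
set A := rowword T in hcat; set B := drop m r in hcat.
have eR : rowword (insertion_tableau w) = A ++ iota s m ++ B.
  by rewrite eT rowword_cons -er cat_take_drop.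
have Up : uniq w by rewrite (perm_uniq hw) iota_uniq.
have kw := knuth_insertion_tableau Up; rewrite eR in kw.
have hw0 : perm_eq (A ++ iota s m ++ B) (iota s n).
  by rewrite -eR; exact: perm_trans (insertion_tableau_perm w) hw.
have [ps [fam sz szf]] := IH _ _ _ k m (catabolism_perm hw0) slam l0 hcat.
have [ps1 [fam1 sz1 szf1]] := path_family_grow hw0 m0 sz fam.
have hs : all (leq s) w by apply/allP => x; rewrite (perm_mem hw) mem_iota => /andP[].
have [_ tr] := knuth_family_transfer kw Up hs.
have [ps2 [fam2 sz2 szf2]] := tr _ _ fam1.
by exists ps2; rewrite fam2 sz2 szf2 sz1 szf1 szf.
Qed.

Lemma syt_head_leq r T y : syt (r :: T) -> y \in rowword (r :: T) -> head 0 r <= y.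
Proof.
elim: T r => [|r2 T IH] r /and4P[rn rs ab hT]; rewrite rowword_cons mem_cat => /orP[].
- by [].
- case: r rn rs {ab} => //= a r _ ra; rewrite inE => /orP[/eqP -> //|yr].
  exact/ltnW/(allP (order_path_min ltn_trans ra)).
- move/(IH _ hT); apply: leq_trans; case/and4P: hT => r2n _ _ _.
  have /aboveP[_ /(_ 0)] := ab; rewrite -!nth0 lt0n size_eq0 => /(_ r2n).
  exact: ltnW.
- case: r rn rs {ab} => //= a r _ ra; rewrite inE => /orP[/eqP -> //|yr].
  exact/ltnW/(allP (order_path_min ltn_trans ra)).
Qed.

(** The last of the [m'] letters is preceded by the others in [r2], so its column, counted from 0,
    is at least [m]; the entry of [r] above it is smaller. *)
Lemma above_interval (r r2 : seq nat) t m m' : sorted ltn r -> sorted ltn r2 ->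
  above r r2 -> (forall j, j < m' -> t + j \in r2) -> m < m' ->
  m < size r /\ nth 0 r m < t + m'.-1.
Proof.
move=> rs r2s /aboveP[sz ab] inr2 mm'.
have b2 : t + m'.-1 \in r2 by apply: inr2; lia.
set b := t + m'.-1 in b2 *; set i := index b r2.
have i2 : i < size r2 by rewrite index_mem.
have mi : m' <= i.+1.
  rewrite -[m'](size_iota t) -(size_takel i2).
  apply: uniq_leq_size; first exact: iota_uniq.
  move=> x; rewrite mem_iota => /andP[x1 x2].
  have x2' : x \in r2 by rewrite -(subnKC x1); apply: inr2; lia.
  have xi : index x r2 <= i.
    rewrite leqNgt; apply/negP => h.
    have h' : index x r2 < size r2 by rewrite index_mem.
    have := nth_ltn_sorted r2s h h'; rewrite !nth_index //.
    by rewrite /b; lia.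
  apply/(nthP 0); exists (index x r2); first by rewrite size_takel.
  by rewrite nth_take ?nth_index.
split; first lia.
rewrite -(nth_index 0 b2); apply: leq_ltn_trans (ab _ i2); rewrite -/i.
by have [->//|mi'] := eqVneq m i; apply/ltnW/nth_ltn_sorted => //; lia.
Qed.

(** This makes the greedy parts weakly decreasing. If [m'] exceeded [m], the next [m'] letters would
    all be in the second row, and the entry of the first row in column [m] would be one of them. *)
Lemma catabolizable_next_part w s n r T m m' lam : perm_eq w (iota s n) ->
  insertion_tableau w = r :: T -> take m r = iota s m -> 0 < m -> 0 < m' ->
  s + m \in rowword T ->
  catabolizable_rec (m' :: lam) (insertion_tableau (drop m r ++ rowword T)) ->
  m' <= m.
Proof.
move=> hw eT er m0 m'0 smT hcat.
have ST : syt (r :: T).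
  by rewrite -eT; apply: syt_insertion_tableau; rewrite (perm_uniq hw) iota_uniq.
set A := rowword T in smT hcat *; set B := drop m r in hcat *.
have hw0 : perm_eq (A ++ iota s m ++ B) (iota s n).
  rewrite -er cat_take_drop -rowword_cons -eT.
  exact: perm_trans (insertion_tableau_perm w) hw.
have hw1 := catabolism_perm hw0.
have [_ UB dAB _] := catabolism_uniq hw0.
have U1 : uniq (B ++ A) by rewrite (perm_uniq hw1) iota_uniq.
have [r' [T' [eT' er']]] := catabolizable_first_row hw1 m'0 hcat.
(* These letters begin the first row of the next tableau, and insertion preserves labels. *)
have l0 j : j < m' -> label (s + m) (B ++ A) (s + m + j) = 0.
  move=> jm; have k1 := knuth_insertion_tableau U1.
  rewrite (knuth_label (s + m) k1) eT' rowword_cons -(cat_take_drop m' r') er'.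
  apply: (label_catabolized (n := n - m)) => //.
  rewrite -er' cat_take_drop -rowword_cons -eT'.
  exact: perm_trans (insertion_tableau_perm _) hw1.
case: T eT ST @A smT hcat hw0 hw1 dAB U1 eT' l0 => [|r2 T] eT ST A smT hcat hw0 hw1 dAB U1 eT' l0; first by [].
case/and4P: ST => rn rs /= ab ST2.
have /and4P[r2n r2s _ _] := ST2.
(* The smallest letter of [B ++ A] must be in the corner of the rows below the first. *)
have hd2 : head 0 r2 = s + m.
  apply/eqP; rewrite eqn_leq (syt_head_leq ST2 smT) /=.
  have : head 0 r2 \in B ++ A.
    by rewrite mem_cat /A rowword_cons mem_cat -nth0 mem_nth ?orbT // lt0n size_eq0.
  by rewrite (mem_catabolism hw0) => /andP[].
have sm2 : s + m \in r2 by rewrite -hd2 -nth0 mem_nth // lt0n size_eq0.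
have smT' : s + m \notin B ++ rowword T.
  move: U1; rewrite /A rowword_cons catA cat_uniq => /and3P[_ /hasPn h _].
  exact: h.
(* With label 0, these letters stand weakly to the right of [s + m], which is in [r2], the last
   factor of [B ++ A]. *)
have inr2 j : j < m' -> s + m + j \in r2.
  move=> jm; have : index (s + m) (B ++ A) <= index (s + m + j) (B ++ A).
    by apply: (@label_eq_index (s + m)); rewrite ?leq_addr // l0 // label_base.
  have : s + m + j \in B ++ A.
    rewrite (perm_mem hw1) mem_iota leq_addr /=.
    have : s + m + j \in rowword (r' :: T').
      by rewrite rowword_cons -(cat_take_drop m' r') er' !mem_cat mem_iota leq_addr ltn_add2l jm orbT.
    rewrite -eT' (perm_mem (insertion_tableau_perm _)) (perm_mem hw1) mem_iota.
    by case/andP.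
  rewrite /A rowword_cons catA !(index_cat _ (B ++ _)) (negbTE smT') mem_cat orbC.
  case/orP=> // h; rewrite h => h2.
  by move: h; rewrite -index_mem ltnNge (leq_trans _ h2) // leq_addr.
rewrite leqNgt; apply/negP => mm'.
have [mr h1] := above_interval rs r2s ab inr2 mm'.
have yB : nth 0 r m \in B.
  by rewrite /B (drop_nth 0 mr) inE eqxx.
have : nth 0 r m \in B ++ A by rewrite mem_cat yB.
rewrite (mem_catabolism hw0) => /andP[h2 _].
have : nth 0 r m \in A.
  rewrite /A rowword_cons mem_cat -(subnKC h2) inr2 ?orbT //.
  by clear - h1 h2 mm'; lia.
by move/dAB; rewrite yB.
Qed.

(** The parts are chosen greedily. Maximality of each puts all letters with label 0 into the run, so
    that cutting paths yields the upper bound. *)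
Lemma catabolizable_exists n w s : perm_eq w (iota s n) ->
  exists nu, [/\ 0 \notin nu, sorted geq nu, sumn nu = n,
    catabolizable_rec nu (insertion_tableau w) &
    forall k ps, path_family s w k ps -> size (flatten ps) <= sumn (take k nu)].
Proof.
elim/ltn_ind: n w s => n IH w s hw.
have [n0|n0] := posnP n.
  move: hw; rewrite n0 => /perm_nilP -> ; exists [::]; split=> // k ps /and4P[_ _ _].
  by case: (flatten ps).
have Up : uniq w by rewrite (perm_uniq hw) iota_uniq.
have hs : all (leq s) w by apply/allP => x; rewrite (perm_mem hw) mem_iota => /andP[].
have kw := knuth_insertion_tableau Up.
have ST := syt_insertion_tableau Up.
have pT : perm_eq (rowword (insertion_tableau w)) (iota s n).
  exact: perm_trans (insertion_tableau_perm w) hw.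
case eT: (insertion_tableau w) pT ST kw => [|r T] pT ST kw.
  by have := perm_size pT; rewrite size_iota /=; lia.
have /and4P[rn rs _ _] := ST.
have pos m : (m <= size r) && (take m r == iota s m) -> m <= size r by case/andP.
(* The corner entry is the minimum, so [m = 1] is always admissible. *)
have ex1 : (1 <= size r) && (take 1 r == iota s 1).
  case: r rn {rs pos eT kw} ST pT => // a r _ ST pT /=; rewrite take0.
  rewrite eqseq_cons andbT eqn_leq; apply/andP; split.
    by apply: (syt_head_leq ST); rewrite (perm_mem pT) mem_iota; lia.
  have : a \in rowword ((a :: r) :: T) by rewrite rowword_cons mem_cat inE eqxx orbT.
  by rewrite (perm_mem pT) mem_iota => /andP[].
case: (ex_maxnP (ex_intro _ 1 ex1) pos) => m /andP[mr /eqP er] mmax.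
have m0 : 0 < m by exact: mmax.
set A := rowword T; set B := drop m r.
have eR : rowword (r :: T) = A ++ iota s m ++ B.
  by rewrite rowword_cons -er cat_take_drop.
have hw0 : perm_eq (A ++ iota s m ++ B) (iota s n) by rewrite -eR.
have hn := catabolism_size hw0.
(* Otherwise [s + m] would be the first entry of [B], and the run could be extended. *)
have m_max : n = m \/ s + m \in A.
  have [->|nm] := eqVneq n m; [by left|right].
  have : s + m \in B ++ A by rewrite (mem_catabolism hw0); lia.
  rewrite mem_cat => /orP[smB|//].
  have Bs : sorted ltn B by exact: drop_sorted.
  have hB x : x \in B -> s + m <= x.
    move=> xB; have : x \in B ++ A by rewrite mem_cat xB.
    by rewrite (mem_catabolism hw0) => /andP[].
  have eB : nth 0 r m = s + m.
    case eB: B smB Bs hB => [//|b B'] smB Bs hB.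
    have -> : nth 0 r m = b by have := nth_drop m 0 r 0; rewrite -/B eB addn0 => <-.
    apply/eqP; rewrite eqn_leq hB ?inE ?eqxx // andbT.
    move: smB; rewrite inE => /orP[/eqP -> //|h].
    exact/ltnW/(allP (order_path_min ltn_trans Bs)).
  have mr' : m < size r.
    by rewrite ltnNge; apply/negP => h; move: smB; rewrite /B drop_oversize.
  suff : m.+1 <= m by rewrite ltnn.
  apply: mmax; rewrite mr' (take_nth 0 mr') eB er -cats1.
  by rewrite -[m.+1]addn1 iotaD /=.
have hw1 := catabolism_perm hw0.
have hlt : n - m < n by rewrite ltn_subrL m0 n0.
have [nu [nu0 nus sumnu catnu bnu]] := IH _ hlt _ _ hw1.
have es : sort leq (rowword (r :: T)) = iota s n.
  apply: (sorted_eq leq_trans anti_leq).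
  - exact: (sort_sorted leq_total).
  - exact: iota_sorted.
  - by rewrite perm_sort.
exists (m :: nu); split.
- by rewrite inE negb_or nu0 andbT eq_sym -lt0n.
- rewrite /=; case: nu nu0 nus sumnu catnu {bnu} => //= m' nu nu0 nus sumnu catnu.
  rewrite nus andbT.
  have m'0 : 0 < m' by rewrite lt0n eq_sym; case/norP: nu0.
  case: m_max => [nm|smA].
    by move/eqP: sumnu; rewrite nm subnn addn_eq0 -leqn0 leqNgt m'0.
  exact: (catabolizable_next_part hw eT er m0 m'0 smA catnu).
- by rewrite /= sumnu subnKC // hn addnAC leq_addl.
- rewrite [catabolizable_rec _ _]/= mr /= es er take_iota; apply/andP; split=> //.
  apply/allP => x; rewrite /= !mem_iota => /andP[-> h] /=.
  by apply: leq_trans h _; rewrite leq_add2l geq_minl.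
- case=> [|k] ps fam.
    case/and4P: fam => _; rewrite take0 leqn0 size_eq0 => /allP h _ _; apply/eqP.
    elim: ps h => //= p ps IHp h; have := h p; rewrite inE eqxx leqn0 => /(_ isT).
    move/eqP/size0nil => ->; apply: IHp => q qp; apply: h; by rewrite inE qp orbT.
  rewrite eR in kw; have [tr _] := knuth_family_transfer kw Up hs.
  have [ps0 [fam0 _ <-]] := tr _ _ fam.
  have [ps1 [fam1 le1]] := path_family_cut hw0 m0 m_max fam0.
  by apply: leq_trans le1 _; rewrite /= leq_add2l; exact: bnu.
Qed.

(** * Chains and paths *)

Lemma cc_labelE w i : cc_label w i = label 1 w i.+1.
Proof. by elim: i => [|i IH]; rewrite ?label_base // label_recr //= IH. Qed.

Definition letter (w : seq nat) (x : int) : nat :=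
  nth 0 w `|((x - 1)%R %% Posz (size w))%Z|%N.

(* The occurrence in w~ of the letter in position q (counted from 0) of w, d
   periods to the left. *)
Definition position (w : seq nat) (q d : nat) : int :=
  (1 + Posz q - Posz d * Posz (size w))%R.

Lemma position_exists w (x : int) : 0 < size w -> (x <= Posz (size w))%R ->
  exists q d, q < size w /\ x = position w q d.
Proof.
move=> n0 xn; set n := Posz (size w).
have n0' : n != 0%R by rewrite /n; lia.
have hx := divz_eq (x - 1)%R n.
have h0 : (0 <= ((x - 1)%R %% n)%Z)%R := modz_ge0 _ n0'.
have h1 : (((x - 1)%R %% n)%Z < n)%R by apply: ltz_pmod; rewrite /n; lia.
(* As [x] is at most [n], the quotient is at most that of [n - 1], which is 0. *)
have hd : (((x - 1)%R %/ n)%Z <= 0)%R.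
  have -> : 0%R = ((n - 1)%R %/ n)%Z.
    by rewrite divz_small // /n; lia.
  by apply: lez_pdiv2r; rewrite /n; lia.
move: hx h0 h1 hd; set q := ((x - 1)%R %% n)%Z; set d := ((x - 1)%R %/ n)%Z.
move=> hx h0 h1 hd.
exists `|q|%N, `|d|%N; split; first by move: h1; rewrite /n; lia.
rewrite /position -/n.
have -> : Posz `|d|%N = (- d)%R by lia.
have -> : Posz `|q|%N = q by lia.
by rewrite GRing.mulNr GRing.opprK; lia.
Qed.

Section Chains.

Variable w : seq nat.
Hypothesis w_std : standard_word w.

Lemma standard_word_uniq : uniq w.
Proof. by rewrite (perm_uniq w_std) iota_uniq. Qed.

Lemma position_divz q d : q < size w ->
  ((position w q d - 1) %/ Posz (size w))%Z = (- Posz d)%R /\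
  ((position w q d - 1) %% Posz (size w))%Z = Posz q.
Proof.
move=> qn; have -> : (position w q d - 1 = (- Posz d) * Posz (size w) + Posz q)%R.
  by rewrite /position; lia.
split; last by rewrite modzMDl modz_small //; lia.
by rewrite divzMDl ?divz_small; lia.
Qed.

Lemma letter_position q d : q < size w -> letter w (position w q d) = nth 0 w q.
Proof. by move=> qn; rewrite /letter (position_divz d qn).2. Qed.

Lemma wtilde_position q d : q < size w ->
  wtilde w (position w q d) = Posz (label 1 w (nth 0 w q) + d).
Proof.
move=> qn; rewrite /wtilde; have [-> ->] := position_divz d qn.
rewrite /= (nth_map 0) // cc_labelE prednK; last first.
  have : nth 0 w q \in w by exact: mem_nth.
  by rewrite (perm_mem w_std) mem_iota => /andP[].
by rewrite GRing.opprK.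
Qed.

Lemma ltz_position q d q' d' : q < size w -> q' < size w ->
  (position w q' d' < position w q d)%R = (d < d') || ((d == d') && (q' < q)).
Proof.
move=> h h'; rewrite /position; apply/idP/idP.
  case: (ltngtP d d') => [//|dd|->] /=; last lia.
  have : d'.+1 * size w <= d * size w by rewrite leq_mul2r dd orbT.
  by rewrite mulSn; lia.
case: (ltngtP d d') => [dd _|//|-> /=]; last lia.
have : d.+1 * size w <= d' * size w by rewrite leq_mul2r dd orbT.
by rewrite mulSn; lia.
Qed.

Lemma letter_mod x y : (x %% Posz (size w) = y %% Posz (size w))%Z ->
  letter w x = letter w y.
Proof.
by move=> e; rewrite /letter -(modzDml x) e modzDml.
Qed.

Lemma letter_index_ltn (x : int) : 0 < size w ->
  `|((x - 1)%R %% Posz (size w))%Z|%N < size w.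
Proof.
move=> n0; have n0' : (0 < Posz (size w))%R by [].
have := ltz_pmod (x - 1)%R n0'; have := modz_ge0 (x - 1)%R (lt0r_neq0 n0').
by case: ((x - 1)%R %% Posz (size w))%Z.
Qed.

Lemma letter_mem x : 0 < size w -> letter w x \in w.
Proof. by move=> n0; apply: mem_nth; exact: letter_index_ltn. Qed.

Lemma mod_letter x y : 0 < size w -> letter w x = letter w y ->
  (x %% Posz (size w) = y %% Posz (size w))%Z.
Proof.
move=> n0 /eqP; rewrite nth_uniq ?letter_index_ltn ?standard_word_uniq // => /eqP e.
have n0' : Posz (size w) != 0%R by rewrite eqz_nat -lt0n.
have e' : ((x - 1)%R %% Posz (size w))%Z = ((y - 1)%R %% Posz (size w))%Z.
  by rewrite -(gez0_abs (modz_ge0 _ n0')) e (gez0_abs (modz_ge0 _ n0')).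
rewrite -(GRing.subrK 1%R x) -(GRing.subrK 1%R y).
by rewrite -modzDml e' modzDml.
Qed.

(** The period counts are [i] and [i.+1] minus the respective labels. So [d < d'] means that the
    label does not rise, and [d = d'] that it rises by one, where the order within the period
    decides. *)
Lemma arrow_position q d q' d' i : q < size w -> q' < size w ->
  wtilde w (position w q d) = Posz i -> wtilde w (position w q' d') = Posz i.+1 ->
  arrow 1 w (letter w (position w q d)) (letter w (position w q' d')) =
  (position w q' d' < position w q d)%R.
Proof.
move=> h h'; rewrite !wtilde_position // => -[e] [e'].
rewrite !letter_position // ltz_position // /arrow.
rewrite !index_uniq ?standard_word_uniq //.
by lia.
Qed.

Lemma chain_label_path j : 0 < size w -> is_chain w j ->
  label_path 1 w [seq letter w x | x <- rev j].
Proof.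
move=> n0 [j0 jn + jw _].
rewrite -[j in sorted _ j]revK rev_sorted.
have rn x : x \in rev j -> (x <= Posz (size w))%R by rewrite mem_rev; exact: jn.
rewrite -(size_rev j) in j0 jw.
case: (rev j) j0 rn jw => // x r _ rn jw hs /=; apply/andP; split.
  have [q [d [qn ex]]] := position_exists n0 (rn x (mem_head _ _)).
  (* The value 0 is the sum of the label and the period count, so the label vanishes. *)
  have := jw 0 isT; rewrite /= ex letter_position // wtilde_position //.
  by lia.
apply/(pathP 0) => i; rewrite size_map => ir.
rewrite -[letter w x :: _]/[seq letter w z | z <- x :: r] !(nth_map 0%R) //=; last by rewrite ltnW.
have hi := rn _ (mem_nth 0%R (ltnW ir : i < size (x :: r))).
have hi' : (nth 0%R r i <= Posz (size w))%R.
  by apply: rn; rewrite inE mem_nth ?orbT.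
have [q [d [qn e]]] := position_exists n0 hi.
have [q' [d' [qn' e']]] := position_exists n0 hi'.
have wi := jw i (ltnW ir : i < size (x :: r)).
have wi' := jw i.+1 ir.
rewrite /= in wi'; rewrite e e' in wi wi' *.
rewrite (arrow_position qn qn' wi wi') -e -e'.
by move/(pathP 0%R): hs; apply.
Qed.

(** Shifting by [i] minus the label gives the value [i]; on label paths the subtraction is not
    truncated, by [label_path_leq]. Chains list the largest value first, whence [rev]. *)
Definition chain_of (p : seq nat) : seq int :=
  rev (mkseq (fun i => position w (index (nth 0 p i) w)
                         (i - label 1 w (nth 0 p i))) (size p)).

(** An arrow raises the label by at most one, and the first label is 0. *)
Lemma label_path_leq p : label_path 1 w p ->
  forall i, i < size p -> label 1 w (nth 0 p i) <= i.
Proof.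
case: p => //= a p /andP[/eqP la /(pathP 0) hp]; elim=> [|i IH] ip /=.
  by rewrite la.
have := hp i ip; rewrite /arrow => /orP[h|/andP[/eqP -> _]].
  by apply: leq_trans h (leq_trans (IH _) _); rewrite // ltnW.
by rewrite ltnS IH // ltnW.
Qed.

Lemma letter_chain_of (p : seq nat) : all (mem w) p ->
  [seq letter w x | x <- chain_of p] = rev p.
Proof.
move=> /allP pw; rewrite /chain_of map_rev /mkseq -map_comp; congr rev.
rewrite -[RHS](mkseq_nth 0); apply/eq_in_map => i; rewrite mem_iota => /andP[_ ip].
rewrite /= letter_position ?nth_index // ?index_mem; apply: pw; exact: mem_nth.
Qed.

Lemma is_chain_of (p : seq nat) : all (mem w) p -> uniq p -> label_path 1 w p ->
  is_chain w (chain_of p).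
Proof.
move=> pw Up lp; have le := label_path_leq lp; have sp : size (chain_of p) = size p.
  by rewrite size_rev size_mkseq.
have pw' i : i < size p -> index (nth 0 p i) w < size w.
  by move=> ip; rewrite index_mem; apply: (allP pw); exact: mem_nth.
have wv i : i < size p -> wtilde w (nth 0%R (rev (chain_of p)) i) = Posz i.
  move=> ip; rewrite revK nth_mkseq // wtilde_position ?pw' // nth_index ?subnKC ?le //.
  by apply: (allP pw); exact: mem_nth.
split.
- by rewrite sp; case: (p) lp.
- move=> x; rewrite mem_rev => /mapP[i]; rewrite mem_iota => /andP[_ ip] ->.
  have := pw' i ip; rewrite /position -PoszM.
  by move: (index _ _) (_ * size w)%N => a b; lia.
- rewrite /chain_of rev_sorted; apply/(sortedP 0%R) => i; rewrite size_mkseq => ip.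
  have := wv i (ltnW ip); have := wv i.+1 ip.
  rewrite revK !nth_mkseq //; last exact: ltnW.
  move=> h2 h1; rewrite -(arrow_position _ _ h1 h2) ?pw' //; last exact: ltnW.
  rewrite !letter_position ?pw' //; last exact: ltnW.
  rewrite !nth_index; try by apply: (allP pw); apply: mem_nth; rewrite // ltnW.
  case: (p) lp ip => //= a p' /andP[_ /(pathP 0) hp] ip; exact: hp.
- by move=> i; rewrite sp; exact: wv.
(* Entries with equal residues carry the same letter, and the letters of [p] are distinct. *)
- have U : uniq [seq letter w x | x <- chain_of p] by rewrite letter_chain_of // rev_uniq.
  rewrite map_inj_in_uniq; first exact: map_uniq U.
  move=> x y xp yp /letter_mod e.
  apply/eqP; rewrite -(nth_index 0%R xp) -(nth_index 0%R yp) nth_uniq ?index_mem ?(map_uniq U) //.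
  rewrite -(nth_uniq 0 _ _ U) ?size_map ?index_mem // !(nth_map 0%R) ?index_mem //.
  by rewrite !nth_index // e.
Qed.

End Chains.

Lemma uniq_flatten_map (S T : eqType) (f : S -> T) (s : seq (seq S)) : uniq s ->
  (forall A, A \in s -> uniq (map f A)) ->
  (forall A B, A \in s -> B \in s -> A <> B ->
     forall a b, a \in A -> b \in B -> f a <> f b) ->
  uniq (map f (flatten s)).
Proof.
elim: s => //= A s IH /andP[As Us] Uf dj; rewrite map_cat cat_uniq Uf ?mem_head //=.
rewrite IH // => [|B Bs|B C Bs Cs]; last 2 first.
- by apply: Uf; rewrite inE Bs orbT.
- by apply: dj; rewrite inE ?Bs ?Cs orbT.
rewrite andbT; apply/hasPn => _ /mapP[b /flattenP[B Bs bB] ->].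
apply/mapP => -[a aA e]; apply: (dj A B) aA bB _; rewrite ?mem_head ?inE ?Bs ?orbT //.
by move=> AB; rewrite AB Bs in As.
Qed.

Lemma uniq_flatten_mem (T : eqType) (s : seq (seq T)) A B x :
  uniq (flatten s) -> A \in s -> B \in s -> x \in A -> x \in B -> A = B.
Proof.
elim: s => //= C s IH; rewrite cat_uniq => /and3P[_ /hasPn dj U].
rewrite !inE => /orP[/eqP->|As] /orP[/eqP->|Bs] // xA xB; last exact: IH.
- by have := dj x; rewrite /= xA => /(_ _) /negP []//; apply/flattenP; exists B.
- by have := dj x; rewrite /= xB => /(_ _) /negP []//; apply/flattenP; exists A.
Qed.

Lemma perm_flatten_rev (T : eqType) (s : seq (seq T)) :
  perm_eq (flatten [seq rev A | A <- s]) (flatten s).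
Proof. by elim: s => //= A s IH; rewrite perm_cat // perm_rev. Qed.

Lemma family_supportE (F : {fset seq int}) :
  family_support F = [fset x in flatten (enum_fset F)]%fset.
Proof.
apply/fsetP => x; rewrite in_fset /=; apply/bigfcupP/flattenP.
  by case=> A; rewrite andbT in_fset => AF xA; exists A.
by case=> A AF xA; exists A; rewrite ?andbT ?in_fset.
Qed.

Lemma card_fset_seq (s : seq int) : #|` [fset x in s]%fset| = size (undup s).
Proof.
rewrite -(undup_id (fset_uniq _)); apply/perm_size/uniq_perm; rewrite ?undup_uniq //.
by move=> x; rewrite !mem_undup in_fset.
Qed.

Section Families.

Variable w : seq nat.
Hypothesis w_std : standard_word w.
Hypothesis w_gt0 : 0 < size w.

(** Residues modulo [size w] correspond to letters, so disjointness of residues becomes disjointness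
    of paths. *)
Lemma path_family_of_chains k F : is_bounded_chain_family w k F ->
  exists ps, path_family 1 w k ps /\ #|` family_support F| <= size (flatten ps).
Proof.
case=> hF dj; pose ps := [seq [seq letter w x | x <- rev A] | A <- enum_fset F].
have eps : flatten ps = map (letter w) (flatten [seq rev A | A <- enum_fset F]).
  by rewrite map_flatten -map_comp.
have pps := perm_map (letter w) (perm_flatten_rev (enum_fset F)).
exists ps; split; last first.
  rewrite family_supportE card_fset_seq eps (perm_size pps) size_map.
  exact: size_undup.
apply/and4P; split.
- by apply/allP => _ /mapP[A AF ->]; apply: chain_label_path => //; have [] := hF A AF.
- by apply/allP => _ /mapP[A AF ->]; rewrite size_map size_rev; have [] := hF A AF.
- rewrite eps (perm_uniq pps); apply: uniq_flatten_map.
  + exact: fset_uniq.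
  + move=> A AF; have [[_ _ _ _ UA] _] := hF A AF.
    rewrite map_inj_in_uniq; first exact: map_uniq UA.
    move=> x y xA yA /(mod_letter w_std w_gt0) e.
    apply/eqP; rewrite -(nth_index 0%R xA) -(nth_index 0%R yA).
    rewrite nth_uniq ?index_mem ?(map_uniq UA) //.
    rewrite -(nth_uniq 0%R _ _ UA) ?size_map ?index_mem // !(nth_map 0%R) ?index_mem //.
    by rewrite !nth_index // e.
  + by move=> A B AF BF AB a b aA bB /(mod_letter w_std w_gt0); exact: dj AB _ _ aA bB.
- rewrite eps; apply/allP => _ /mapP[x _ ->]; exact: letter_mem.
Qed.

Lemma chains_of_path_family k ps : path_family 1 w k ps ->
  exists F, is_bounded_chain_family w k F /\ #|` family_support F| = size (flatten ps).
Proof.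
case/and4P=> /allP lp /allP lk U /allP sub.
pose F := [fset A in [seq chain_of w p | p <- ps]]%fset.
have inF A : A \in F -> exists2 p, p \in ps & A = chain_of w p.
  by rewrite in_fset => /mapP.
have pw p : p \in ps -> all (mem w) p.
  by move=> pps; apply/allP => x xp; apply: sub; apply/flattenP; exists p.
have Up p : p \in ps -> uniq p.
  move=> pps; move: U; rewrite (perm_uniq (perm_flatten (perm_to_rem pps))) /=.
  by rewrite cat_uniq => /and3P[].
have mem_letter A p a : p \in ps -> A = chain_of w p -> a \in A -> letter w a \in p.
  move=> pps -> ha; rewrite -mem_rev -(letter_chain_of w_std (pw p pps)).
  exact: map_f.
exists F; split.
  split=> [A /inF[p pps ->]|A B /inF[p pps eA] /inF[q qps eB] AB a b aA bB e].
    split; last by rewrite size_rev size_mkseq; exact: lk.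
    by apply: is_chain_of => //; [exact: pw|exact: Up|exact: lp].
  apply: AB; rewrite eA eB; congr chain_of.
  apply: (uniq_flatten_mem (x := letter w a) U pps qps); first exact: mem_letter aA.
  by rewrite (letter_mod e); exact: mem_letter bB.
have -> : family_support F = [fset x in flatten [seq chain_of w p | p <- ps]]%fset.
  apply/fsetP => x; rewrite family_supportE !in_fset.
  by apply/flattenP/flattenP => -[A AF xA]; exists A => //; move: AF; rewrite in_fset.
have e : map (letter w) (flatten [seq chain_of w p | p <- ps]) = flatten [seq rev p | p <- ps].
  rewrite map_flatten -map_comp; congr flatten; apply/eq_in_map => p pps.
  exact: letter_chain_of (pw p pps).
have pe := perm_flatten_rev ps.
rewrite card_fset_seq undup_id.
  by rewrite -(size_map (letter w)) e (perm_size pe).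
by apply: (map_uniq (f := letter w)); rewrite e (perm_uniq pe).
Qed.

End Families.

(* For the empty word, all residues mod 0 are distinct and w~ vanishes on the
   nonpositive integers, so that the sizes of the chain families are unbounded
   and max_family_size takes its default value. *)
Lemma max_family_size_nil k : 0 < k -> max_family_size k [::] = 0.
Proof.
move=> k0; apply: xgetPN => s [_ /= bd].
pose c (i : nat) : int := (- Posz i)%R.
(* One more one-element chain than the supposed maximum [s] allows. *)
pose F := [fset A in [seq [:: c i] | i <- iota 0 s.+1]]%fset.
have inF A : A \in F -> exists i, A = [:: c i].
  by rewrite in_fset => /mapP[i _ ->]; exists i.
have fam : is_bounded_chain_family [::] k F.
  split=> [A /inF[i ->]|A B /inF[i ->] /inF[j ->] AB a b].
    split=> //; split=> // [x|[|//] _].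
      by rewrite inE => /eqP ->; rewrite /c /=; lia.
    by rewrite /wtilde /= divz0 nth_nil.
  by rewrite !inE => /eqP -> /eqP ->; rewrite !modz0 => e; apply: AB; rewrite e.
have := bd F fam; rewrite family_supportE card_fset_seq leqNgt => /negP; apply.
rewrite -[X in X < _](size_iota 0) -(size_map c).
have -> : (size [seq c i | i <- iota 0 s]).+1 = size [seq c i | i <- iota 0 s.+1].
  by rewrite !size_map !size_iota.
apply: uniq_leq_size.
  by rewrite map_inj_uniq ?iota_uniq // => x y; rewrite /c; lia.
move=> x /mapP[i ii ->]; rewrite mem_undup; apply/flattenP.
by exists [:: c i]; rewrite ?mem_head // in_fset; apply/mapP; exists i.
Qed.

(** * Dominance and the comparison of the two sums *)

Lemma dominated_eq (a b : seq nat) : 0 \notin a -> 0 \notin b ->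
  (forall i, sumn (take i a) = sumn (take i b)) -> a = b.
Proof.
elim: a b => [|x a IH] [|y b] // a0 b0 h.
- by have := h 1; rewrite /= take0 /= in b0 *; move: b0; rewrite inE; lia.
- by have := h 1; rewrite /= take0 /= in a0 *; move: a0; rewrite inE; lia.
have xy : x = y by have := h 1; rewrite /= !take0 /=; lia.
move: a0 b0; rewrite !inE !negb_or => /andP[_ a0] /andP[_ b0].
by rewrite xy (IH b) // => i; have := h i.+1; rewrite /= xy; lia.
Qed.

Lemma sum_nth_take k (a : seq nat) : \sum_(i < k) nth 0 a i = sumn (take k a).
Proof.
elim: a k => [|x a IH] [|k]; rewrite ?big_ord0 //.
  by rewrite big1 // => i _; rewrite nth_nil.
by rewrite big_ord_recl /= IH.
Qed.

Theorem theorem3p11 (w : seq nat) (hw : standard_word w)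
    (k : nat) (hk : 0 < k) :
  \sum_(i < k) nth 0 (ctype w) i = max_family_size k w.
Proof.
set T := insertion_tableau w.
have [nu [nu0 nus sumnu catnu bnu]] := catabolizable_exists hw.
have sT : size (rowword T) = size w.
  exact: perm_size (insertion_tableau_perm w).
have lam_family lam j : catabolizable lam T -> exists ps,
    path_family 1 w j ps /\ size (flatten ps) = sumn (take j lam).
  case/and3P=> /andP[lams lam0] _ catlam.
  (* The number of paths is irrelevant for this claim, and the first part itself serves as the
     bound. *)
  have hs : sorted geq (head 0 lam :: lam).
    by case: (lam) lams => //= m l ->; rewrite leqnn.
  by have [ps [fam _ sz]] := catabolizable_family j hw hs lam0 catlam; exists ps.
have nuT : catabolizable nu T.
  by rewrite /catabolizable /is_partition nus nu0 sT sumnu eqxx.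
(* The partial sums of [lam] are sizes of path families, which the partial sums of [nu] bound. *)
have nu_max lam : catabolizable lam T -> dominated lam nu.
  by move=> hlam j; have [ps [/bnu h <-]] := lam_family lam j hlam.
have part0 lam : catabolizable lam T -> 0 \notin lam by case/and3P=> /andP[].
have -> : ctype w = nu.
  apply: xget_unique => [|lam [hlam lam_max]]; last first.
    by rewrite (lam_max nu) //; exact: nu_max.
  split=> // mu hmu dom; apply: dominated_eq; rewrite ?part0 // => i.
  by apply/eqP; rewrite eqn_leq dom nu_max.
rewrite sum_nth_take.
have [w0|w_gt0] := posnP (size w).
  rewrite (size0nil w0) max_family_size_nil //.
  by move: nu0 sumnu; rewrite w0; case: (nu) => [|[|m] l].
apply/esym/xget_unique.
  split; last first.
    move=> F /(path_family_of_chains hw w_gt0)[ps [/bnu le1 le2]].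
    exact: leq_trans le2 le1.
  have [ps [fam sz]] := lam_family nu k nuT.
  have [F [hF sF]] := chains_of_path_family hw fam.
  by exists F; rewrite sF.
move=> s [[F [hF <-]] bd]; apply/eqP; rewrite eqn_leq.
have [ps [/bnu le1 le2]] := path_family_of_chains hw w_gt0 hF.
rewrite (leq_trans le2 le1) /=.
have [qs [fam <-]] := lam_family nu k nuT.
have [G [hG <-]] := chains_of_path_family hw fam.
exact: bd.
Qed.
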